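(* Let $n\ge1$ be an integer, $\mu\in\mathbb{R}$, and let $\alpha,\beta\in\mathbb{R}$. Let $I_{\alpha\beta}$ be the fractional integral operator on $\mathbb{R}^{2n+1}$ with kernel $V^{\alpha\beta}$, as defined in the context, and let $1<p<q<\infty$. Then there is a constant $C_{p,q}>0$ such that $$\|I_{\alpha\beta}f\|_{L^q(\mathbb{R}^{2n+1})}\le C_{p,q}\,\|f\|_{L^p(\mathbb{R}^{2n+1})}\qquad\text{for all } f\in L^p(\mathbb{R}^{2n+1})$$ if and only if $$\frac{\alpha+\beta}{n+1}=\frac1p-\frac1q.$$
   Context: Points of $\mathbb{R}^{2n+1}$ are written $(u,v,t)\in\mathbb{R}^n\times\mathbb{R}^n\times\mathbb{R}$. For fixed $\mu\in\mathbb{R}$, the Heisenberg-type multiplication law is $$(u,v,t)\odot(\xi,\eta,\tau)=\big(u+\xi,\;v+\eta,\;t+\tau+\mu(u\cdot\eta-v\cdot\xi)\big),\qquad (\xi,\eta,\tau)^{-1}=(-\xi,-\eta,-\tau),$$ so that $(u,v,t)\odot(\xi,\eta,\tau)^{-1}=\big(u-\xi,\;v-\eta,\;t-\tau-\mu(u\cdot\eta-v\cdot\xi)\big)$. The kernel is $$V^{\alpha\beta}(\xi,\eta,\tau)=|\xi|^{\alpha-n}\,|\eta|^{\alpha-n}\,|\tau|^{\beta-1}\left[\frac{|\xi||\eta|}{|\tau|}+\frac{|\tau|}{|\xi||\eta|}\right]^{-\frac{|\alpha-n\beta|}{n+1}},\qquad \xi\ne0,\ \eta\ne0,\ \tau\ne0,$$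 regarded as an almost everywhere defined nonnegative function on $\mathbb{R}^{2n+1}$, and $$I_{\alpha\beta}f(u,v,t)=\iiint_{\mathbb{R}^{2n+1}} f(\xi,\eta,\tau)\,V^{\alpha\beta}\big[(u,v,t)\odot(\xi,\eta,\tau)^{-1}\big]\,d\xi\,d\eta\,d\tau .$$ For $f\ge0$ the integral takes values in $[0,\infty]$; the norm inequality for all $f\in L^p$ includes that the integral converges absolutely for almost every $(u,v,t)$. The constant $C_{p,q}$ depends only on its sub-indices ($n$ and $\mu$ being fixed). *)

(* Defs.v *)
From HB Require Import structures.
From mathcomp Require Import all_boot all_order all_algebra.
From mathcomp Require Import all_classical all_reals all_analysis.
Import Order.TTheory GRing.Theory Num.Theory.
Import numFieldNormedType.Exports.

Set Implicit Arguments.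
Unset Strict Implicit.
Unset Printing Implicit Defensive.

Local Open Scope classical_set_scope.
Local Open Scope ring_scope.

Lemma sigma_finite_prod d1 d2 (T1 : measurableType d1) (T2 : measurableType d2)
    (R : realType) (m1 : {sigma_finite_measure set T1 -> \bar R})
    (m2 : {sigma_finite_measure set T2 -> \bar R}) :
  sigma_finite setT (m1 \x m2)%E.
Proof.
have /sigma_finiteP[F [TF ndF Foo]] := sigma_finiteT m1.
have /sigma_finiteP[G [TG ndG Goo]] := sigma_finiteT m2.
exists (fun n => F n `*` G n).
  rewrite -setXTT TF TG predeqE => -[x y]; split.
    move=> [/= [n _ Fnx] [k _ Gky]]; exists (maxn n k) => //; split.
    - by move: x Fnx; exact/subsetPset/ndF/leq_maxl.
    - by move: y Gky; exact/subsetPset/ndG/leq_maxr.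
  by move=> [n _ []/= ? ?]; split; exists n.
move=> k; have [? ?] := Foo k; have [? ?] := Goo k.
split; first exact: measurableX.
by rewrite product_measure1E// lte_mul_pinfty// ge0_fin_numE.
Qed.

Section LebesgueMeasureSucc.
Context (R : realType) (n : nat).
Variable m : {sigma_finite_measure set (n.-tuple (measurableTypeR R)) -> \bar R}.

Definition cons_pair (z : measurableTypeR R * n.-tuple (measurableTypeR R)) :
  n.+1.-tuple (measurableTypeR R) := [tuple of z.1 :: z.2].

Lemma measurable_cons_pair : measurable_fun [set: _] cons_pair.
Proof. exact: measurable_cons measurable_fst measurable_snd. Qed.

HB.instance Definition _ :=
  isMeasurableFun.Build _ _ _ _ cons_pair measurable_cons_pair.

Definition lebesgue_tuple_succ :=
  pushforward ((@lebesgue_measure R) \x m)%E cons_pair.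

Let lebesgue_tuple_succ0 : lebesgue_tuple_succ set0 = 0%E.
Proof. exact: measure0. Qed.

Let lebesgue_tuple_succ_ge0 A : (0 <= lebesgue_tuple_succ A)%E.
Proof. exact: measure_ge0. Qed.

Let lebesgue_tuple_succ_sigma_additive :
  semi_sigma_additive lebesgue_tuple_succ.
Proof. exact: measure_semi_sigma_additive. Qed.

HB.instance Definition _ := isMeasure.Build _ _ _ lebesgue_tuple_succ
  lebesgue_tuple_succ0 lebesgue_tuple_succ_ge0
  lebesgue_tuple_succ_sigma_additive.

Let sigma_finite_lebesgue_tuple_succ : sigma_finite setT lebesgue_tuple_succ.
Proof.
pose uncons (t : n.+1.-tuple (measurableTypeR R)) :=
  (thead t, [tuple of behead t] : n.-tuple (measurableTypeR R)).
have muncons : measurable_fun [set: _] uncons.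
  apply/measurable_fun_pairP; split; first exact: measurable_tnth.
  exact: measurable_behead.
have [F UF mF] := sigma_finite_prod (@lebesgue_measure R) m.
exists (fun i => uncons @^-1` F i).
  by rewrite -preimage_bigcup -UF preimage_setT.
move=> i; have [mFi Fioo] := mF i; split.
  by rewrite -[X in measurable X]setTI; exact: muncons.
rewrite /lebesgue_tuple_succ /pushforward.
rewrite (_ : cons_pair @^-1` _ = F i)//.
rewrite -comp_preimage (_ : uncons \o cons_pair = id) ?preimage_id//.
apply/funext => -[x y]; rewrite /uncons /cons_pair /=; congr pair.
exact: val_inj.
Qed.

HB.instance Definition _ := Measure_isSigmaFinite.Build _ _ _
  lebesgue_tuple_succ sigma_finite_lebesgue_tuple_succ.

End LebesgueMeasureSucc.

(* Lebesgue measure on R^n, realized as [n.-tuple R], on the Borel (= product)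
   sigma-algebra.  By [lebesgue_tuple_box] it is the measure giving a box the
   product of the lengths of its sides. *)
Fixpoint lebesgue_tuple (R : realType) (n : nat) :
    {sigma_finite_measure set (n.-tuple (measurableTypeR R)) -> \bar R} :=
  match n with
  | 0 => \d_([tuple] : 0.-tuple (measurableTypeR R))
  | n'.+1 => lebesgue_tuple_succ (lebesgue_tuple R n')
  end.

Lemma lebesgue_tuple_box (R : realType) (n : nat)
    (A : 'I_n -> set (measurableTypeR R)) : (forall i, measurable (A i)) ->
  lebesgue_tuple R n [set x | forall i, A i (tnth x i)] =
  (\prod_(i < n) lebesgue_measure (A i))%E.
Proof.
elim: n A => [|n IH] A mA.
  rewrite big_ord0 /= diracE mem_set// => i.
  by case: i.
rewrite big_ord_recl -IH// -product_measure1E//; last first.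
  rewrite (_ : [set x | _] =
      \bigcap_(i in [set: 'I_n]) ((@tnth _ _)^~ i @^-1` A (lift ord0 i))).
    apply: fin_bigcap_measurable => // i _.
    by rewrite -[X in measurable X]setTI; exact: measurable_tnth.
  by apply/seteqP; split => [x Ax i _|x Ax i]; exact: Ax.
rewrite /= /lebesgue_tuple_succ /pushforward; congr (_ _).
apply/seteqP; split => -[x y] /= => [Axy|[Ax Ay] i].
  split; first exact: (Axy ord0).
  by move=> i; have := Axy (lift ord0 i); rewrite tnthS.
by case: (unliftP ord0 i) => [j ->|->//]; rewrite tnthS.
Qed.

Section Heisenberg.
Context (R : realType) (n : nat).
Local Notation vec := (n.-tuple (measurableTypeR R)).

Definition dotv (x y : vec) : R := \sum_(i < n) tnth x i * tnth y i.

Definition enorm (x : vec) : R := Num.sqrt (dotv x x).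

Definition addv (x y : vec) : vec := [tuple (tnth x i + tnth y i : R) | i < n].

Definition oppv (x : vec) : vec := [tuple (- tnth x i : R) | i < n].

(* R^(2n+1) *)
Local Notation hpoint := (vec * vec * measurableTypeR R)%type.

Definition hlebesgue : {measure set (vec * vec * measurableTypeR R) -> \bar R} :=
  ((lebesgue_tuple R n \x lebesgue_tuple R n) \x (@lebesgue_measure R))%E.

Definition hmul (mu : R) (x y : hpoint) : hpoint :=
  let: (u, v, t) := x in let: (xi, eta, tau) := y in
  (addv u xi, addv v eta, t + tau + mu * (dotv u eta - dotv v xi)).

Definition hinv (x : hpoint) : hpoint :=
  let: (xi, eta, tau) := x in (oppv xi, oppv eta, - tau).

(* The kernel is only defined where xi, eta and tau are all nonzero; on the
   remaining null set it is set to 0. *)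
Definition hkernel (alpha beta : R) (x : hpoint) : R :=
  let: (xi, eta, tau) := x in
  let a := enorm xi in let b := enorm eta in let c := `|tau : R| in
  if [|| a == 0, b == 0 | c == 0] then 0
  else a `^ (alpha - n%:R) * b `^ (alpha - n%:R) * c `^ (beta - 1) *
       (a * b / c + c / (a * b)) `^ (- (`|alpha - n%:R * beta| / n.+1%:R)).

Definition hintegrand (mu alpha beta : R) (f : hpoint -> R) (x y : hpoint) :
    \bar R :=
  (f y * hkernel alpha beta (hmul mu x (hinv y)))%:E.

Definition hfracint (mu alpha beta : R) (f : hpoint -> R) (x : hpoint) :
    \bar R :=
  (\int[hlebesgue]_y hintegrand mu alpha beta f x y)%E.

(* The L^p -> L^q inequality with constant C.  Almost everywhere absolute
   convergence of the integral is required separately, because the library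
   integral of a non-integrable signed function also has a value. *)
Definition hfracint_bounded (mu alpha beta p q C : R) : Prop :=
  forall f : hpoint -> R, f \in Lfun hlebesgue p%:E ->
    {ae hlebesgue, forall x,
      hlebesgue.-integrable setT (hintegrand mu alpha beta f x)} /\
    ('N[hlebesgue]_q%:E[hfracint mu alpha beta f] <=
      C%:E * 'N[hlebesgue]_p%:E[EFin \o f])%E.

End Heisenberg.

(* Main.v *)
Require Import Defs.
From HB Require Import structures.
From mathcomp Require Import all_boot all_order all_algebra.
From mathcomp Require Import all_classical all_reals all_analysis.
From mathcomp Require Import measurable_realfun ring lra.
Import Order.TTheory GRing.Theory Num.Theory.
Import numFieldNormedType.Exports.

Set Implicit Arguments.
Unset Strict Implicit.
Unset Printing Implicit Defensive.

Local Open Scope classical_set_scope.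
Local Open Scope ring_scope.

(** Write sg = 1/p - 1/q, alpha = n sg + d and beta = sg - d. With
    w = |xi||eta|/|tau| the kernel is |xi|^(n(sg-1)) |eta|^(n(sg-1)) |tau|^(sg-1)
    times w^d (w + 1/w)^(-|d|), and the last factor is at most 1. So it suffices
    to treat the product kernel, uniformly in d. Once the horizontal variables
    are frozen, the group twist only translates the last variable; the product
    form is therefore bounded by iterating the Hardy-Littlewood-Sobolev form
    on R, R^n and R^n, and L^q bounds follow by duality. All forms are written
    in terms of the densities |f|^p and |g|^q', so that iteration is Tonelli's
    theorem.

    The Hardy-Littlewood-Sobolev form is bounded for every kernel of weak type
    on both sides. If f^p >= g^q' at (x, y), the level (f x)^(p/r) of the
    kernel separates two regions: on the high one g is replaced by the larger
    power of f, on the low one Young's inequality is used.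

    Conversely, the indicator of a box of size L x L x L^2 and its image on a
    comparable box at distance L give k L^e <= C for all L > 0, where e vanishes
    exactly under the homogeneity condition. *)

(** * Truncated integrals of weak-type kernels *)

Section WeakType.
Context d (T : measurableType d) (R : realType).
Variable m : {measure set T -> \bar R}.

(** Every point where [h] is positive lies in some [E j] with [h y <= c j], so [h] is at most the
    sum of the [c j] times the indicators of the [E j]; termwise integration leaves a geometric
    series. *)
Lemma integral_le_geometric (h : T -> R) (E : nat -> set T) (c : nat -> R)
    (D l : R) :
  measurable_fun setT h -> (forall y, 0 <= h y) ->
  (forall j, measurable (E j)) -> (forall j, 0 <= c j) ->
  (forall j, ((c j)%:E * m (E j) <= (D * l ^+ j)%:E)%E) ->
  0 <= D -> 0 <= l < 1 ->
  (forall y, 0 < h y -> exists2 j, E j y & h y <= c j) ->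
  (\int[m]_y (h y)%:E <= (D / (1 - l))%:E)%E.
Proof.
move=> mh h0 mE c0 cE D0 /andP[l0 l1] hE.
pose F j y : \bar R := ((c j)%:E * (\1_(E j) y)%:E)%E.
have F0 j y : (0 <= F j y)%E by rewrite mule_ge0// lee_fin.
have mF j : measurable_fun setT (F j).
  by apply: measurable_funeM; apply/measurable_EFinP; exact: measurable_indic.
have hF y : ((h y)%:E <= \sum_(j <oo) F j y)%E.
  have := h0 y; rewrite le_eqVlt => /predU1P[hy0|/hE[j Ej hj]].
    by rewrite -hy0; exact: nneseries_ge0.
  apply: (le_trans _ (@nneseries_lim_ge _ _ xpredT 0 j.+1 _)) => //.
  rewrite big_nat_recr//= -[leLHS]add0e; apply: leeD; first exact: sume_ge0.
  by rewrite /F indicE mem_set// mule1 lee_fin.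
apply: (@le_trans _ _ (\int[m]_y \sum_(j <oo) F j y)%E).
  apply: ge0_le_integral => //.
  - by move=> y _; rewrite lee_fin.
  - exact/measurable_EFinP.
  - exact: ge0_emeasurable_sum.
rewrite integral_nneseries//.
have -> : (D / (1 - l))%:E = (\sum_(j <oo) (D * l ^+ j)%:E)%E.
  apply/esym/cvg_lim => //.
  have := @cvg_geometric_series R D l; rewrite ger0_norm// => /(_ l1) H.
  suff -> : (fun n => \sum_(0 <= j < n) (D * l ^+ j)%:E)%E =
      EFin \o series (geometric D l) by apply: cvg_EFin => //; exact: nearW.
  by apply/funext => n /=; rewrite /series/= sumEFin.
apply: lee_nneseries => [j _ _|j _]; first exact: integral_ge0.
rewrite ge0_integralZl//; first by rewrite integral_indic// setIT.
- by apply/measurable_EFinP; exact: measurable_indic.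
by rewrite lee_fin.
Qed.

Lemma dyadic_bracket (x : R) : 1 <= x ->
  exists j : nat, 2 ^+ j <= x < 2 ^+ j.+1.
Proof.
move=> x1.
have /ex_minnP[[|j] xj jmin] : exists j, x < 2 ^+ j.
- by exists (Num.bound x); exact: upper_nthrootP.
- by move: xj; rewrite expr0 ltNge x1.
exists j; rewrite xj andbT leNgt; apply/negP => /jmin.
by rewrite ltnn.
Qed.

Lemma powR_geometric (x b e : R) (j : nat) : 0 <= x -> 0 <= b ->
  (x * b ^+ j) `^ e = x `^ e * (b `^ e) ^+ j.
Proof.
move=> x0 b0; rewrite powRM ?exprn_ge0//; congr (_ * _).
by rewrite -[b ^+ j]powR_mulrn// -[RHS]powR_mulrn ?powR_ge0// powRAC.
Qed.

Lemma half_powRN (x e : R) : 0 <= x -> (x / 2) `^ (- e) = x `^ (- e) * 2 `^ e.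
Proof.
by move=> x0; rewrite powRM// -(powR_inv1 (ler0n _ 2)) -powRrM mulN1r opprK.
Qed.

Lemma powR_lt1 (b e : R) : 1 < b -> e < 0 -> b `^ e < 1.
Proof.
move=> b1 e0; rewrite /powR gt_eqF ?(lt_trans ltr01)//.
by rewrite -expR0 ltr_expR nmulr_rlt0// ln_gt0.
Qed.

Definition superlevel (k : T -> R) (t : R) := [set y | t < k y].

(** For nonnegative [k] this is membership in weak L^r, with [A] bounding the r-th power of the
    quasinorm. *)
Definition weak_type (k : T -> R) (A r : R) :=
  forall t : R, 0 < t -> (m (superlevel k t) <= (A * t `^ (- r))%:E)%E.

Variables (k : T -> R) (A r : R).
Hypotheses (mk : measurable_fun setT k) (k0 : forall y, 0 <= k y).
Hypotheses (A0 : 0 <= A) (kA : weak_type k A r).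

Let mlevel t : measurable (superlevel k t).
Proof.
rewrite (_ : superlevel k t = k @^-1` `]t, +oo[); last first.
  by apply/seteqP; split => y /=; rewrite in_itv/= andbT.
by rewrite -[X in measurable X]setTI; exact: mk.
Qed.

(** The shell where [k] is about t 2^j contributes at most a constant times (t 2^j)^(1 - r), which
    is summable over j >= 0 because r > 1. *)
Lemma integral_weak_type_large (t : R) : 1 < r -> 0 < t ->
  (\int[m]_y (if t < k y then k y else 0)%:E <=
   (2 * 2 `^ r * A * t `^ (1 - r) / (1 - 2 `^ (1 - r)))%:E)%E.
Proof.
move=> r1 t0.
have x0 j : 0 < t * 2 ^+ j by rewrite mulr_gt0// exprn_gt0.
(* Dyadic bracketing gives only [t * 2 ^+ j <= k y], while [superlevel] is strict; halving the level
   repairs this at the cost of a factor 2^r. *)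
apply: (@integral_le_geometric _ (fun j => superlevel k (t * 2 ^+ j / 2))
  (fun j => 2 * (t * 2 ^+ j))).
- by apply: measurable_fun_ifT => //; exact: measurable_fun_ltr.
- by move=> y; case: ifP.
- by move=> j; exact: mlevel.
- by move=> j; rewrite mulr_ge0// ltW.
- move=> j; apply: (@le_trans _ _ ((2 * (t * 2 ^+ j))%:E *
    (A * (t * 2 ^+ j / 2) `^ (- r))%:E)%E).
    rewrite lee_pmul2l ?fin_num_ge0//; last by rewrite lte_fin mulr_gt0.
    by apply: kA; rewrite divr_gt0.
  rewrite -EFinM lee_fin -[leRHS]mulrA -powR_geometric ?(ltW t0)//.
  rewrite powRD ?(gt_eqF (x0 j)) ?implybT// powRr1 ?(ltW (x0 j))//.
  by rewrite half_powRN ?(ltW (x0 j))//; rewrite le_eqVlt; apply/orP; left; apply/eqP; ring.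
- by rewrite !mulr_ge0 ?powR_ge0.
- by rewrite powR_ge0/= powR_lt1// ?ltr1n// subr_lt0.
- move=> y; case: ifPn => [ty _|]; last by rewrite ltxx.
  have := @dyadic_bracket (k y / t); rewrite ler_pdivlMr// mul1r => /(_ (ltW ty)).
  move=> [j /andP[]]; rewrite ler_pdivlMr// ltr_pdivrMr// => h1 h2.
  exists j => /=; last by rewrite mulrCA mulrC -exprS ltW.
  rewrite mulrC in h1; apply: lt_le_trans h1.
  by have := x0 j; set z := _ * _; lra.
Qed.

(** The shells now descend from [t] to 0; the one at height t 2^-j contributes a multiple of (t
    2^-j)^(v - r), and r < v gives convergence. *)
Lemma integral_weak_type_small (v t : R) : 0 < r < v -> 0 < t ->
  (\int[m]_y (if k y <= t then k y `^ v else 0)%:E <=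
   (2 `^ r * A * t `^ (v - r) / (1 - 2^-1 `^ (v - r)))%:E)%E.
Proof.
move=> /andP[r0 rv] t0; have v0 : 0 < v by exact: lt_trans rv.
have x0 j : 0 < t * 2^-1 ^+ j by rewrite mulr_gt0// exprn_gt0.
apply: (@integral_le_geometric _ (fun j => superlevel k (t * 2^-1 ^+ j / 2))
  (fun j => (t * 2^-1 ^+ j) `^ v)).
- apply: measurable_fun_ifT => //; first exact: measurable_fun_ler.
  by apply: (measurableT_comp (measurable_powR v)).
- by move=> y; case: ifP; rewrite ?powR_ge0.
- by move=> j; exact: mlevel.
- by move=> j; exact: powR_ge0.
- move=> j; apply: (@le_trans _ _ (((t * 2^-1 ^+ j) `^ v)%:E *
    (A * (t * 2^-1 ^+ j / 2) `^ (- r))%:E)%E).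
    rewrite lee_pmul2l ?fin_num_ge0//; last by rewrite lte_fin powR_gt0.
    by apply: kA; rewrite divr_gt0.
  rewrite -EFinM lee_fin -[leRHS]mulrA -powR_geometric ?(ltW t0) ?invr_ge0//.
  rewrite powRD ?(gt_eqF (x0 j)) ?implybT//.
  by rewrite half_powRN ?(ltW (x0 j))//; rewrite le_eqVlt; apply/orP; left; apply/eqP; ring.
- by rewrite !mulr_ge0 ?powR_ge0.
- rewrite powR_ge0/= -(powR_inv1 (ler0n _ 2)) -powRrM mulN1r.
  by rewrite powR_lt1// ?ltr1n// oppr_lt0 subr_gt0.
- move=> y; case: ifPn => [ty kv|]; last by rewrite ltxx.
  (* The zero set of [k] lies in no shell, but there k^v vanishes since [v] is positive. *)
  have := k0 y; rewrite le_eqVlt => /predU1P[ky0|ky].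
    by move: kv; rewrite -ky0 powR0 ?(gt_eqF v0)// ltxx.
  have := @dyadic_bracket (t / k y); rewrite ler_pdivlMr// mul1r => /(_ ty).
  move=> [j /andP[]]; rewrite ler_pdivlMr// ltr_pdivrMr// => h1 h2.
  have e0 : 0 < (2 : R) ^+ j by rewrite exprn_gt0.
  exists j; rewrite /superlevel /= exprVn.
    by rewrite -mulrA -invfM -exprSr ltr_pdivrMr ?exprn_gt0// mulrC.
  apply: ge0_ler_powR; rewrite ?nnegrE ?(ltW v0)//; first exact/ltW/divr_gt0.
  by rewrite ler_pdivlMr// mulrC.
Qed.

End WeakType.

(** * Half of the Hardy-Littlewood-Sobolev form at a fixed point *)

Section HalfForm.
Context d (T : measurableType d) (R : realType).
Variable m : {measure set T -> \bar R}.
Variables (th ph A : R).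
Hypotheses (th01 : 0 < th < 1) (ph01 : 0 < ph < 1) (thph : 1 < th + ph).
Hypothesis A0 : 0 <= A.

(** [r] is the kernel exponent forced by scaling in the Hardy-Littlewood-Sobolev inequality, and [v]
    is the conjugate exponent of [ph^-1], as Young's inequality will require. *)
Let r := (2 - th - ph)^-1.
Let v := (1 - ph)^-1.

Definition hls_large : R := 2 * 2 `^ r * A / (1 - 2 `^ (1 - r)).
Definition hls_small : R := 2 `^ r * A / (1 - 2^-1 `^ (v - r)).

Let r1 : 1 < r.
Proof. by rewrite /r invf_gt1; move: th01 ph01 thph => /andP[? ?] /andP[? ?] ?; lra. Qed.

Let rv : r < v.
Proof.
by rewrite /r /v ltf_pV2 ?posrE; move: th01 ph01 thph => /andP[? ?] /andP[? ?] ?; lra.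
Qed.

Lemma hls_large_ge0 : 0 <= hls_large.
Proof.
rewrite /hls_large divr_ge0 ?mulr_ge0 ?powR_ge0//.
by rewrite subr_ge0 ltW// powR_lt1 ?ltr1n// subr_lt0.
Qed.

Lemma hls_small_ge0 : 0 <= hls_small.
Proof.
rewrite /hls_small divr_ge0 ?mulr_ge0 ?powR_ge0// subr_ge0 ltW//.
rewrite -(powR_inv1 (ler0n _ 2)) -powRrM mulN1r.
by rewrite powR_lt1// ?ltr1n// oppr_lt0 subr_gt0.
Qed.

(** Where [k] exceeds a^(1/r), the bound b <= a replaces b^ph by a^ph. Elsewhere Young's inequality
    with exponents 1/ph and [v] separates [b] from [k]. *)
Lemma young_split (a b k : R) : 0 < a -> 0 <= b -> 0 <= k ->
  (if b <= a then a `^ th * b `^ ph * k else 0) <=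
  a `^ (th + ph) * (if a `^ r^-1 < k then k else 0) +
  (a * b + a `^ (th - (1 - th) * ph * v) *
    (if k <= a `^ r^-1 then k `^ v else 0)).
Proof.
move=> a0 b0 k0; move: th01 ph01 => /andP[th0 th1] /andP[ph0 ph1].
case: ifPn => [ba|_]; last first.
  by rewrite addr_ge0 ?addr_ge0 ?mulr_ge0 ?powR_ge0 ?(ltW a0)//;
    case: ifP => //; rewrite powR_ge0.
case: (ltP (a `^ r^-1) k) => [Tk|kT].
  rewrite mulr0 addr0 powRD ?(gt_eqF a0) ?implybT// -[leLHS]addr0 lerD//.
    by rewrite ler_wpM2r// ler_wpM2l ?powR_ge0// ge0_ler_powR ?nnegrE ?(ltW ph0) ?(ltW a0).
  by rewrite mulr_ge0 ?(ltW a0).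
(* Young's inequality is applied to c b^ph and k / c. This [c] makes a^th c^(1/ph) b equal to a b;
   the numerical factors [ph] and 1/v are bounded by 1. *)
rewrite mulr0 add0r; pose c := a `^ ((1 - th) * ph).
have c0 : 0 < c by rewrite powR_gt0.
have v0 : 0 < v by rewrite invr_gt0 subr_gt0.
have := @conjugate_powR R (c * b `^ ph) (k / c) ph^-1 v.
rewrite mulr_ge0 ?powR_ge0 ?(ltW c0)// divr_ge0 ?(ltW c0)// invr_gt0 ph0 v0.
rewrite !invrK addrC subrK => /(_ isT isT isT isT erefl).
rewrite (_ : c * b `^ ph * (k / c) = b `^ ph * k); last by field; rewrite gt_eqF.
rewrite powRM ?powR_ge0 ?(ltW c0)// -!powRrM.
rewrite mulfK ?gt_eqF// mulfV ?gt_eqF// powRr1//.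
rewrite powRM ?invr_ge0 ?(ltW c0)// -(powR_inv1 (ltW c0)) -!powRrM.
move=> H.
rewrite -mulrA; apply: le_trans (ler_wpM2l (powR_ge0 _ _) H) _.
rewrite mulrDr lerD//.
  rewrite 2!(mulrA (a `^ th)) -powRD ?(gt_eqF a0) ?implybT//.
  rewrite addrC subrK powRr1 ?(ltW a0)//.
  by rewrite ler_piMr ?mulr_ge0 ?(ltW a0) ?(ltW ph1).
rewrite mulN1r mulrN powRD ?(gt_eqF a0) ?implybT// -[leRHS]mulrA ler_wpM2l ?powR_ge0//.
by rewrite [leRHS]mulrC ler_piMr ?mulr_ge0 ?powR_ge0// gerBl ltW.
Qed.

Variables (k b : T -> R).
Hypotheses (mk : measurable_fun setT k) (k0 : forall y, 0 <= k y).
Hypotheses (mb : measurable_fun setT b) (b0 : forall y, 0 <= b y).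
Hypotheses (kA : weak_type m k A r) (b1 : (\int[m]_y (b y)%:E <= 1)%E).

(** At the threshold a^(1/r) all three terms of [young_split] integrate to multiples of the first
    power of [a]. This linearity lets the remaining integration use only the integral of the density
    whose value is [a]. *)
Lemma integral_half_form (a : R) : 0 <= a ->
  (\int[m]_y (if b y <= a then a `^ th * b y `^ ph * k y else 0)%:E <=
   (a * (hls_large + 1 + hls_small))%:E)%E.
Proof.
move: (th01) (ph01) => /andP[th0 th1] /andP[ph0 ph1].
have mle (f g h : T -> R) : measurable_fun setT f -> measurable_fun setT g ->
  measurable_fun setT h ->
  measurable_fun setT (fun y => if f y <= g y then h y else 0).
  by move=> *; apply: measurable_fun_ifT => //; exact: measurable_fun_ler.
have mF : measurable_fun setT
    (fun y => (if b y <= a then a `^ th * b y `^ ph * k y else 0)%:E).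
  apply/measurable_EFinP/mle => //; apply: measurable_funM => //.
  by apply: measurable_funM => //; exact: (measurableT_comp (measurable_powR ph)).
have F0 y : 0 <= (if b y <= a then a `^ th * b y `^ ph * k y else 0).
  by case: ifP => // _; rewrite !mulr_ge0 ?powR_ge0.
rewrite le_eqVlt => /predU1P[<-|a0].
  rewrite mul0r (eq_integral (cst 0%E)) ?integral0// => y _.
  by case: ifP => //; rewrite powR0 ?gt_eqF// !mul0r.
pose t := a `^ r^-1.
have t0 : 0 < t by rewrite powR_gt0.
pose F1 y := (if t < k y then k y else 0)%:E.
pose F2 y := (if k y <= t then k y `^ v else 0)%:E.
have mF1 : measurable_fun setT F1.
  by apply/measurable_EFinP/measurable_fun_ifT => //; exact: measurable_fun_ltr.
have mF2 : measurable_fun setT F2.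
  by apply/measurable_EFinP/mle => //; exact: (measurableT_comp (measurable_powR v)).
have F10 y : (0 <= F1 y)%E by rewrite lee_fin; case: ifP.
have F20 y : (0 <= F2 y)%E by rewrite lee_fin; case: ifP; rewrite ?powR_ge0.
pose c1 := a `^ (th + ph); pose c2 := a `^ (th - (1 - th) * ph * v).
have mG : measurable_fun setT (fun y => (c1%:E * F1 y +
    (a%:E * (b y)%:E + c2%:E * F2 y))%E).
  apply: emeasurable_funD; first exact: measurable_funeM.
  by apply: emeasurable_funD; apply: measurable_funeM => //; exact/measurable_EFinP.
have c10 : (0 <= c1%:E)%E by rewrite lee_fin powR_ge0.
have c20 : (0 <= c2%:E)%E by rewrite lee_fin powR_ge0.
have aE0 : (0 <= a%:E)%E by rewrite lee_fin ltW.
have mbE : measurable_fun setT (EFin \o b) by exact/measurable_EFinP.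
have bE0 y : (0 <= (b y)%:E)%E by rewrite lee_fin.
have := @ge0_le_integral _ _ _ m _ measurableT _ _ _ mF mG.
move=> /(_ _ _)/le_trans; apply.
- by move=> y _; rewrite lee_fin.
- move=> y _; rewrite -!EFinM -!EFinD lee_fin; exact: young_split.
rewrite ge0_integralD//; last 4 first.
- by move=> y _; rewrite mule_ge0.
- exact: measurable_funeM.
- by move=> y _; rewrite adde_ge0// mule_ge0.
- by apply: emeasurable_funD; exact: measurable_funeM.
rewrite ge0_integralD//; last 4 first.
- by move=> y _; rewrite mule_ge0.
- exact: measurable_funeM.
- by move=> y _; rewrite mule_ge0.
- exact: measurable_funeM.
rewrite !ge0_integralZl//.
have C2 : (c2%:E * \int[m]_y F2 y <= (a * hls_small)%:E)%E.
  have := @integral_weak_type_small _ _ _ m _ _ _ mk k0 A0 kA v t _ t0.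
  move=> /(_ _)/(lee_wpmul2l c20) H; apply: le_trans (H _) _.
    by rewrite rv (lt_trans ltr01 r1).
  rewrite -EFinM lee_fin le_eqVlt; apply/orP; left; apply/eqP.
  rewrite -powRrM /hls_small; set D := 1 - 2^-1 `^ (v - r).
  transitivity (2 `^ r * A / D * (c2 * a `^ (r^-1 * (v - r)))); first by ring.
  rewrite /c2 -powRD ?(gt_eqF a0) ?implybT//.
  have -> : th - (1 - th) * ph * v + r^-1 * (v - r) = 1.
    by rewrite /r /v invrK; field; rewrite !gt_eqF//; lra.
  by rewrite powRr1 ?(ltW a0)//; ring.
have C1 : (c1%:E * \int[m]_y F1 y <= (a * hls_large)%:E)%E.
  apply: le_trans (lee_wpmul2l c10 (integral_weak_type_large mk k0 A0 kA r1 t0)) _.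
  rewrite -EFinM lee_fin le_eqVlt; apply/orP; left; apply/eqP.
  rewrite -powRrM /hls_large; set D := 1 - 2 `^ (1 - r).
  transitivity (2 * 2 `^ r * A / D * (c1 * a `^ (r^-1 * (1 - r)))); first by ring.
  rewrite /c1 -powRD ?(gt_eqF a0) ?implybT//.
  have -> : th + ph + r^-1 * (1 - r) = 1.
    by rewrite /r invrK; field; rewrite !gt_eqF//; lra.
  by rewrite powRr1 ?(ltW a0)//; ring.
rewrite !mulrDr mulr1 -addrA !EFinD; apply: leeD => //; apply: leeD => //.
by rewrite -[leRHS]mule1 lee_wpmul2l.
Qed.

End HalfForm.

(** * Bilinear forms in powers of densities *)

Lemma integral_ge0_ae_eq d (T : measurableType d) (R : realType)
    (m : {measure set T -> \bar R}) (f : T -> \bar R) (p : R) :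
  measurable_fun setT f -> (forall x, 0 <= f x)%E -> (\int[m]_x f x = p%:E)%E ->
  ae_eq m setT f (EFin \o fine \o f).
Proof.
move=> mf f0 fp.
have /integrable_ae : m.-integrable setT f.
  apply/integrableP; split => //.
  under eq_integral do rewrite gee0_abs//.
  by rewrite fp ltry.
move=> /(_ measurableT); apply: filterS => x /= h /h fx.
by rewrite fineK.
Qed.

Section Forms.
Context d1 d2 (T1 : measurableType d1) (T2 : measurableType d2) (R : realType).
Variables (m1 : {sigma_finite_measure set T1 -> \bar R})
          (m2 : {sigma_finite_measure set T2 -> \bar R}).
Local Open Scope ereal_scope.

(** With f = |F|^a, g = |G|^b, s = 1/a and t = 1/b this is the bilinear form with kernel [k] at |F|
    and |G|, and a bound by powers of the integrals is a bound by the norms of F and G. *)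
Definition powform (k : T1 * T2 -> R) (s t : R) (f : T1 -> \bar R)
    (g : T2 -> \bar R) : \bar R :=
  \int[m1]_x \int[m2]_y (f x `^ s * g y `^ t * (k (x, y))%:E).

Definition powform_bounded (k : T1 * T2 -> R) (s t C : R) :=
  forall (f : T1 -> \bar R) (g : T2 -> \bar R),
  measurable_fun setT f -> measurable_fun setT g ->
  (forall x, 0 <= f x) -> (forall y, 0 <= g y) ->
  powform k s t f g <= C%:E * ((\int[m1]_x f x) `^ s * (\int[m2]_y g y) `^ t).

Variables (k : T1 * T2 -> R) (s t : R).
Hypotheses (mk : measurable_fun setT k) (k0 : forall z, (0 <= k z)%R).

Lemma measurable_powform (f : T1 -> \bar R) (g : T2 -> \bar R) :
  measurable_fun setT f -> measurable_fun setT g ->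
  measurable_fun setT
    (fun z : T1 * T2 => f z.1 `^ s * g z.2 `^ t * (k z)%:E).
Proof.
move=> mf mg; apply: emeasurable_funM; last exact/measurable_EFinP.
apply: emeasurable_funM.
  exact: (measurableT_comp (measurable_poweR s) (measurableT_comp mf measurable_fst)).
exact: (measurableT_comp (measurable_poweR t) (measurableT_comp mg measurable_snd)).
Qed.

Lemma powform_arg_ge0 (f : T1 -> \bar R) (g : T2 -> \bar R) z :
  0 <= f z.1 `^ s * g z.2 `^ t * (k z)%:E.
Proof. by rewrite !mule_ge0 ?poweR_ge0// lee_fin. Qed.

Lemma ae_eq_powform (f f' : T1 -> \bar R) (g g' : T2 -> \bar R) :
  measurable_fun setT f -> measurable_fun setT g ->
  measurable_fun setT f' -> measurable_fun setT g' ->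
  ae_eq m1 setT f f' -> ae_eq m2 setT g g' ->
  powform k s t f g = powform k s t f' g'.
Proof.
move=> mf mg mf' mg' ff' gg'; apply: ge0_ae_eq_integral => //.
- exact: (measurable_fun_fubini_tonelli_F _ (measurable_powform mf mg)
    (powform_arg_ge0 f g)).
- exact: (measurable_fun_fubini_tonelli_F _ (measurable_powform mf' mg')
    (powform_arg_ge0 f' g')).
- by move=> x _; apply: integral_ge0 => y _; exact: (powform_arg_ge0 f g (x, y)).
- by move=> x _; apply: integral_ge0 => y _; exact: (powform_arg_ge0 f' g' (x, y)).
apply: filterS ff' => x /= + _ => /(_ Logic.I) ->.
apply: ge0_ae_eq_integral => //.
- exact: (measurableT_comp (measurable_powform mf' mg) (pair1_measurable x)).
- exact: (measurableT_comp (measurable_powform mf' mg') (pair1_measurable x)).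
- by move=> y _; exact: (powform_arg_ge0 f' g (x, y)).
- by move=> y _; exact: (powform_arg_ge0 f' g' (x, y)).
by apply: filterS gg' => y /= + _ => /(_ Logic.I) ->.
Qed.

(** Both sides are homogeneous of degree [s] in [f] and [t] in [g], so one may divide by the
    integrals. A zero integral makes the form vanish, and an infinite one beside a nonzero one makes
    the right side infinite. *)
Lemma powform_bounded_of_normalized (C : R) : (0 < s)%R -> (0 < t)%R -> (0 < C)%R ->
  (forall (f : T1 -> R) (g : T2 -> R),
    measurable_fun setT f -> measurable_fun setT g ->
    (forall x, (0 <= f x)%R) -> (forall y, (0 <= g y)%R) ->
    \int[m1]_x (f x)%:E <= 1 -> \int[m2]_y (g y)%:E <= 1 ->
    powform k s t (EFin \o f) (EFin \o g) <= C%:E) ->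
  powform_bounded k s t C.
Proof.
move=> s0 t0 C0 H f g mf mg f0 g0.
have /integral_ge0 P0 : forall x, setT x -> 0 <= f x by [].
have /integral_ge0 Q0 : forall x, setT x -> 0 <= g x by [].
have m0 d (T : measurableType d) : measurable_fun setT (cst (0 : \bar R) : T -> \bar R).
  exact: measurable_cst.
have zero d (T : measurableType d) (m : {measure set T -> \bar R}) (h : T -> \bar R) :
    measurable_fun setT h -> (forall x, 0 <= h x) -> \int[m]_x h x = 0 ->
    ae_eq m setT h (cst 0).
  move=> mh h0 hm; apply/(ae_eq_integral_abs m measurableT mh).
  by under eq_integral do rewrite gee0_abs//.
have [P|P] := eqVneq (\int[m1]_x f x) 0.
  rewrite (@ae_eq_powform _ (cst 0) g g)//; [|exact: zero|exact: ae_eq_refl].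
  rewrite /powform (eq_integral (cst 0)) ?integral0.
    by rewrite !mule_ge0 ?poweR_ge0// lee_fin ltW.
  move=> x _; rewrite (eq_integral (cst 0)) ?integral0// => y _.
  by rewrite /= powR0 ?gt_eqF// !mul0e.
have [Q|Q] := eqVneq (\int[m2]_y g y) 0.
  rewrite (@ae_eq_powform f f _ (cst 0))//; [|exact: ae_eq_refl|exact: zero].
  rewrite /powform (eq_integral (cst 0)) ?integral0.
    by rewrite !mule_ge0 ?poweR_ge0// lee_fin ltW.
  move=> x _; rewrite (eq_integral (cst 0)) ?integral0// => y _.
  by rewrite /= powR0 ?gt_eqF// mule0 mul0e.
have {}P0 : 0 < \int[m1]_x f x by rewrite lt0e P P0.
have {}Q0 : 0 < \int[m2]_x g x by rewrite lt0e Q Q0.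
have [Py|Py] := eqVneq (\int[m1]_x f x) +oo.
  by rewrite Py poweRyr ?gt_eqF// gt0_mulye ?poweR_gt0// gt0_muley ?lte_fin// leey.
have [Qy|Qy] := eqVneq (\int[m2]_y g y) +oo.
  by rewrite Qy poweRyr ?gt_eqF// gt0_muley ?poweR_gt0// gt0_muley ?lte_fin// leey.
have Pf : \int[m1]_x f x \is a fin_num by rewrite ge0_fin_numE ?ltW// ltey.
have Qf : \int[m2]_x g x \is a fin_num by rewrite ge0_fin_numE ?ltW// ltey.
pose q := fine (\int[m1]_x f x); pose p := fine (\int[m2]_y g y).
have eqq : \int[m1]_x f x = q%:E by rewrite fineK.
have eqp : \int[m2]_y g y = p%:E by rewrite fineK.
have q0 : (0 < q)%R by rewrite -lte_fin -eqq.
have p0 : (0 < p)%R by rewrite -lte_fin -eqp.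
rewrite eqp eqq.
(* [fine] changes the densities only where they are infinite, which is a null set because their
   integrals are finite. *)
pose f' x := (fine (f x) / q)%R; pose g' y := (fine (g y) / p)%R.
have ff' : ae_eq m1 setT f (fun x => (q * f' x)%:E).
  apply: filterS (integral_ge0_ae_eq mf f0 eqq) => x /= h /h ->.
  by rewrite /f' mulrC divfK// gt_eqF.
have gg' : ae_eq m2 setT g (fun x => (p * g' x)%:E).
  apply: filterS (integral_ge0_ae_eq mg g0 eqp) => x /= h /h ->.
  by rewrite /g' mulrC divfK// gt_eqF.
have mf' : measurable_fun setT f'.
  by apply: measurable_funM => //; apply: measurableT_comp => //; exact: measurable_fine.
have mg' : measurable_fun setT g'.
  by apply: measurable_funM => //; apply: measurableT_comp => //; exact: measurable_fine.
have f'0 x : (0 <= f' x)%R by rewrite divr_ge0 ?fine_ge0// ltW.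
have g'0 x : (0 <= g' x)%R by rewrite divr_ge0 ?fine_ge0// ltW.
have mqf' : measurable_fun setT (fun x => (q * f' x)%:E).
  by apply/measurable_EFinP/measurable_funM.
have mpg' : measurable_fun setT (fun x => (p * g' x)%:E).
  by apply/measurable_EFinP/measurable_funM.
have If' : \int[m1]_x (f' x)%:E <= 1.
  rewrite -(@lee_pmul2l _ q%:E) ?lte_fin// mule1 -ge0_integralZl//; first last.
  - by rewrite lee_fin ltW.
  - by move=> x _; rewrite lee_fin.
  - exact/measurable_EFinP.
  by under eq_integral do rewrite -EFinM; rewrite -eqq (ae_eq_integral _ _ _ _ _ ff').
have Ig' : \int[m2]_x (g' x)%:E <= 1.
  rewrite -(@lee_pmul2l _ p%:E) ?lte_fin// mule1 -ge0_integralZl//; first last.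
  - by rewrite lee_fin ltW.
  - by move=> x _; rewrite lee_fin.
  - exact/measurable_EFinP.
  by under eq_integral do rewrite -EFinM; rewrite -eqp (ae_eq_integral _ _ _ _ _ gg').
rewrite (ae_eq_powform mf mg mqf' mpg' ff' gg').
have c0 : (0 <= q `^ s * p `^ t)%R by rewrite mulr_ge0 ?powR_ge0.
have cE0 : 0 <= (q `^ s * p `^ t)%:E by rewrite lee_fin.
rewrite (_ : C%:E * _ = (q `^ s * p `^ t)%:E * C%:E); last first.
  by rewrite !poweR_EFin -!EFinM mulrC.
apply: le_trans (lee_wpmul2l cE0 (H f' g' mf' mg' f'0 g'0 If' Ig')).
have mE1 : measurable_fun setT (EFin \o f') by exact/measurable_EFinP.
have mE2 : measurable_fun setT (EFin \o g') by exact/measurable_EFinP.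
have mp := measurable_powform mE1 mE2.
rewrite /powform -ge0_integralZl//; first last.
- by move=> x _; apply: integral_ge0 => y _; exact: (powform_arg_ge0 _ _ (x, y)).
- exact: (measurable_fun_fubini_tonelli_F _ mp (powform_arg_ge0 _ _)).
rewrite le_eqVlt; apply/predU1P; left; apply: eq_integral => x _.
rewrite -ge0_integralZl//; first last.
- by move=> y _; exact: (powform_arg_ge0 _ _ (x, y)).
- exact: (measurableT_comp mp (pair1_measurable x)).
apply/eq_integral => y _ /=; rewrite -!EFinM.
rewrite !powRM ?(ltW q0) ?(ltW p0) ?f'0 ?g'0 ?fine_ge0 ?invr_ge0 ?(ltW q0) ?(ltW p0)//.
by congr EFin; ring.
Qed.

End Forms.

(** * The Hardy-Littlewood-Sobolev inequality for weak-type kernels *)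

(** The integral of a nonnegative function is a supremum over the simple functions below it, and
    this supremum grows with the function whether or not it is measurable. *)
Lemma ge0_le_integralT d (T : measurableType d) (R : realType)
    (m : {measure set T -> \bar R}) (f g : T -> \bar R) :
  (forall x, 0 <= f x)%E -> (forall x, f x <= g x)%E ->
  (\int[m]_x f x <= \int[m]_x g x)%E.
Proof.
move=> f0 fg; have g0 x : (0 <= g x)%E := le_trans (f0 x) (fg x).
rewrite !ge0_integralTE//; apply: ereal_sup_le => _ [h hf <-].
exists h => // x.
exact: le_trans (hf x) (fg x).
Qed.

(* The library makes [product_measure1] canonically sigma-finite only for
   subprobabilities, hence this alias. *)
Definition sigma_finite_product d1 d2 (T1 : measurableType d1)
    (T2 : measurableType d2) (R : realType)
    (m1 : {sigma_finite_measure set T1 -> \bar R})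
    (m2 : {sigma_finite_measure set T2 -> \bar R}) : set (T1 * T2) -> \bar R :=
  (m1 \x m2)%E.

HB.instance Definition _ d1 d2 (T1 : measurableType d1) (T2 : measurableType d2)
    (R : realType) (m1 : {sigma_finite_measure set T1 -> \bar R})
    (m2 : {sigma_finite_measure set T2 -> \bar R}) :=
  Measure.copy (sigma_finite_product m1 m2) (m1 \x m2)%E.

HB.instance Definition _ d1 d2 (T1 : measurableType d1) (T2 : measurableType d2)
    (R : realType) (m1 : {sigma_finite_measure set T1 -> \bar R})
    (m2 : {sigma_finite_measure set T2 -> \bar R}) :=
  Measure_isSigmaFinite.Build _ _ _ (sigma_finite_product m1 m2)
    (sigma_finite_prod m1 m2).

Definition hls_const (R : realType) (s t A : R) : R :=
  hls_large s t A + 1 + hls_small s t A.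

Lemma hls_const_gt0 (R : realType) (s t A : R) :
  0 < s < 1 -> 0 < t < 1 -> 1 < s + t -> 0 <= A -> 0 < hls_const s t A.
Proof.
move=> s01 t01 st A0.
by rewrite /hls_const addrAC ltr_wpDl// addr_ge0// ?hls_large_ge0 ?hls_small_ge0.
Qed.

Section HLS.
Context d1 d2 (T1 : measurableType d1) (T2 : measurableType d2) (R : realType).
Variables (m1 : {sigma_finite_measure set T1 -> \bar R})
          (m2 : {sigma_finite_measure set T2 -> \bar R}).
Local Open Scope ereal_scope.

(** The form is at most the sum of its parts over g <= f and f <= g. By [integral_half_form] the
    inner integral is at most a multiple of [f x] on the first part and of [g y] on the second, and
    both densities have integral at most 1. *)
Theorem weak_type_powform_bounded (k : T1 * T2 -> R) (s t A : R) :
  (0 < s < 1)%R -> (0 < t < 1)%R -> (1 < s + t)%R -> (0 <= A)%R ->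
  measurable_fun setT k -> (forall z, (0 <= k z)%R) ->
  (forall x, weak_type m2 (fun y => k (x, y)) A (2 - s - t)^-1) ->
  (forall y, weak_type m1 (fun x => k (x, y)) A (2 - s - t)^-1) ->
  powform_bounded m1 m2 k s t (hls_const s t A + hls_const t s A).
Proof.
move=> s01 t01 st A0 mk k0 k2 k1.
have ts : (1 < t + s)%R by rewrite addrC.
have rE : (2 - s - t = 2 - t - s)%R by rewrite addrAC.
have C1 := hls_const_gt0 s01 t01 st A0; have C2 := hls_const_gt0 t01 s01 ts A0.
move: (s01) (t01) => /andP[s0 s1] /andP[t0 t1].
apply: powform_bounded_of_normalized => //; first by rewrite addr_gt0.
move=> f g mf mg f0 g0 f1 g1.
have mf1 : measurable_fun setT (fun z : T1 * T2 => f z.1).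
  exact: (measurableT_comp mf measurable_fst).
have mg2 : measurable_fun setT (fun z : T1 * T2 => g z.2).
  exact: (measurableT_comp mg measurable_snd).
have mfs : measurable_fun setT (fun z : T1 * T2 => f z.1 `^ s)%R.
  exact: (measurableT_comp (measurable_powR s) mf1).
have mgt : measurable_fun setT (fun z : T1 * T2 => g z.2 `^ t)%R.
  exact: (measurableT_comp (measurable_powR t) mg2).
pose H1 z := (if g z.2 <= f z.1 then f z.1 `^ s * g z.2 `^ t * k z else 0)%R.
pose H2 z := (if f z.1 <= g z.2 then g z.2 `^ t * f z.1 `^ s * k z else 0)%R.
have mH1 : measurable_fun setT (EFin \o H1).
  apply/measurable_EFinP/measurable_fun_ifT => //; first exact: measurable_fun_ler.
  by apply: measurable_funM => //; exact: measurable_funM.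
have mH2 : measurable_fun setT (EFin \o H2).
  apply/measurable_EFinP/measurable_fun_ifT => //; first exact: measurable_fun_ler.
  by apply: measurable_funM => //; exact: measurable_funM.
have H10 z : 0 <= (EFin \o H1) z.
  by rewrite lee_fin /H1; case: ifP => // _; rewrite !mulr_ge0 ?powR_ge0.
have H20 z : 0 <= (EFin \o H2) z.
  by rewrite lee_fin /H2; case: ifP => // _; rewrite !mulr_ge0 ?powR_ge0.
have mk1 y : measurable_fun setT (fun x => k (x, y)).
  exact: (measurableT_comp mk (pair2_measurable y)).
have mk2 x : measurable_fun setT (fun y => k (x, y)).
  exact: (measurableT_comp mk (pair1_measurable x)).
apply: (@le_trans _ _ (\int[m1]_x \int[m2]_y ((H1 (x, y))%:E + (H2 (x, y))%:E))).
  have F0 x y := powform_arg_ge0 s t k0 (EFin \o f) (EFin \o g) (x, y).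
  apply: ge0_le_integralT => x; first by apply: integral_ge0 => y _; exact: F0.
  apply: ge0_le_integralT => y; first exact: F0.
  rewrite /= -!EFinM -EFinD lee_fin /H1 /H2/= (mulrC (g y `^ t)%R).
  have : (0 <= f x `^ s * g y `^ t * k (x, y))%R by rewrite !mulr_ge0 ?powR_ge0.
  move: (f x `^ s * g y `^ t * k (x, y))%R => P P0.
  by case: (leP (g y) (f x)) => gf; case: (leP (f x) (g y)) => fg; lra.
under eq_integral => x _.
  rewrite ge0_integralD//; first last.
  - exact: (measurableT_comp mH2 (pair1_measurable x)).
  - by move=> y _; exact: H20.
  - exact: (measurableT_comp mH1 (pair1_measurable x)).
  - by move=> y _; exact: H10.
  over.
rewrite ge0_integralD//; first last.
- exact: (measurable_fun_fubini_tonelli_F _ mH2).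
- by move=> x _; apply: integral_ge0 => y _; exact: H20.
- exact: (measurable_fun_fubini_tonelli_F _ mH1).
- by move=> x _; apply: integral_ge0 => y _; exact: H10.
(* On the part f <= g the inner integral must run over x, the variable of the smaller density. *)
rewrite [X in _ + X](fubini_tonelli _ mH2)// EFinD.
have mfE : measurable_fun setT (EFin \o f) by exact/measurable_EFinP.
have mgE : measurable_fun setT (EFin \o g) by exact/measurable_EFinP.
apply: leeD.
  apply: (@le_trans _ _ (\int[m1]_x ((hls_const s t A)%:E * (f x)%:E))).
    apply: ge0_le_integralT => x; first by apply: integral_ge0 => y _; exact: H10.
    rewrite -EFinM mulrC.
    exact: (integral_half_form s01 t01 st A0 (mk2 x) (fun y => k0 (x, y)) mg g0 (k2 x) g1 (f0 x)).
  rewrite ge0_integralZl//; last by rewrite lee_fin ltW.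
  - by rewrite -[leRHS]mule1 lee_wpmul2l// lee_fin ltW.
  - by move=> x _; rewrite lee_fin.
apply: (@le_trans _ _ (\int[m2]_y ((hls_const t s A)%:E * (g y)%:E))).
  apply: ge0_le_integralT => y; first by apply: integral_ge0 => x _; exact: H20.
  rewrite -EFinM mulrC.
  apply: (integral_half_form t01 s01 ts A0 (mk1 y) (fun x => k0 (x, y)) mf f0 _ f1 (g0 y)) => //.
  by rewrite -rE; exact: k1.
rewrite ge0_integralZl//; last by rewrite lee_fin ltW.
- by rewrite -[leRHS]mule1 lee_wpmul2l// lee_fin ltW.
- by move=> x _; rewrite lee_fin.
Qed.

End HLS.

(** * Iteration over product spaces *)

Section Iteration.
Context dx1 dx2 dy1 dy2 (X1 : measurableType dx1) (X2 : measurableType dx2)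
  (Y1 : measurableType dy1) (Y2 : measurableType dy2) (R : realType).
Variables (m1 : {sigma_finite_measure set X1 -> \bar R})
          (m2 : {sigma_finite_measure set X2 -> \bar R})
          (n1 : {sigma_finite_measure set Y1 -> \bar R})
          (n2 : {sigma_finite_measure set Y2 -> \bar R}).
Local Open Scope ereal_scope.

(** The bound for [h x1 y1], applied to slices of [f] and [g], leaves powers of their marginals, to
    which the bound for [k1] applies. The kernel [h] may vary with x1 and y1 while [C2] stays fixed;
    this accommodates the group twist. *)
Theorem powform_bounded_prod (k1 : X1 * Y1 -> R) (h : X1 -> Y1 -> X2 * Y2 -> R)
    (K : (X1 * X2) * (Y1 * Y2) -> R) (s t C1 C2 : R) :
  (0 <= C2)%R ->
  measurable_fun setT k1 -> (forall z, (0 <= k1 z)%R) ->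
  (forall x y, measurable_fun setT (h x y)) -> (forall x y z, (0 <= h x y z)%R) ->
  measurable_fun setT K ->
  (forall x1 x2 y1 y2,
    K ((x1, x2), (y1, y2)) = (k1 (x1, y1) * h x1 y1 (x2, y2))%R) ->
  powform_bounded m1 n1 k1 s t C1 ->
  (forall x y, powform_bounded m2 n2 (h x y) s t C2) ->
  powform_bounded (sigma_finite_product m1 m2) (sigma_finite_product n1 n2)
    K s t (C1 * C2)%R.
Proof.
move=> C20 mk1 k10 mh h0 mK KE k1C hC f g mf mg f0 g0.
have K0 z : (0 <= K z)%R by case: z => [[? ?] [? ?]]; rewrite KE mulr_ge0.
pose F (z : (X1 * X2) * (Y1 * Y2)) := f z.1 `^ s * g z.2 `^ t * (K z)%:E.
have mF : measurable_fun setT F := measurable_powform s t mK mf mg.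
have F0 z : 0 <= F z := powform_arg_ge0 s t K0 f g z.
pose f1 x1 := \int[m2]_x2 f (x1, x2); pose g1 y1 := \int[n2]_y2 g (y1, y2).
have mf1 : measurable_fun setT f1 := measurable_fun_fubini_tonelli_F _ mf f0.
have mg1 : measurable_fun setT g1 := measurable_fun_fubini_tonelli_F _ mg g0.
have f10 x : 0 <= f1 x by exact: integral_ge0.
have g10 x : 0 <= g1 x by exact: integral_ge0.
rewrite (fubini_tonelli1 _ mf f0 : \int[sigma_finite_product m1 m2]_x f x = _).
rewrite (fubini_tonelli1 _ mg g0 : \int[sigma_finite_product n1 n2]_x g x = _).
rewrite EFinM (muleC C1%:E) -muleA.
have C2E0 : 0 <= C2%:E by rewrite lee_fin.
apply: le_trans (lee_wpmul2l C2E0 (k1C f1 g1 mf1 mg1 f10 g10)).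
have mp := measurable_powform s t mk1 mf1 mg1.
have p0 := powform_arg_ge0 s t k10 f1 g1.
rewrite /powform -ge0_integralZl//; first last.
- by move=> x _; apply: integral_ge0 => y _; exact: (p0 (x, y)).
- exact: (measurable_fun_fubini_tonelli_F _ mp).
have mF1 := measurable_fun_fubini_tonelli_F (m2 := sigma_finite_product n1 n2) _ mF F0.
rewrite (fubini_tonelli1 _ mF1 (fun x => integral_ge0 _ (fun y _ => F0 (x, y)))
  : \int[sigma_finite_product m1 m2]_x \int[_]_y F (x, y) = _).
apply: ge0_le_integralT => x1.
  by apply: integral_ge0 => x2 _; exact: integral_ge0.
rewrite -ge0_integralZl//; first last.
- by move=> y _; exact: (p0 (x1, y)).
- exact: (measurableT_comp mp (pair1_measurable x1)).
(* This regrouping lets Tonelli's theorem exchange [x2] and [y1] while [y2] stays innermost. *)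
pose G (z : (X2 * Y1) * Y2) := F ((x1, z.1.1), (z.1.2, z.2)).
have mG : measurable_fun setT G.
  apply: (measurableT_comp mF); apply: measurable_fun_pair.
    apply: measurable_fun_pair => //.
    exact: (measurableT_comp measurable_fst measurable_fst).
  apply: measurable_fun_pair => //.
  exact: (measurableT_comp measurable_snd measurable_fst).
have G0 z : 0 <= G z by exact: F0.
rewrite (_ : fubini_F m2 _ x1 =
    \int[m2]_x2 \int[n1]_y1 \int[n2]_y2 G ((x2, y1), y2)); last first.
  apply: eq_integral => x2 _.
  exact: (fubini_tonelli1 _ (measurableT_comp mF (pair1_measurable (x1, x2)))
    (fun y => F0 ((x1, x2), y))).
rewrite (fubini_tonelli _ (measurable_fun_fubini_tonelli_F _ mG G0)); last first.
  by move=> z; exact: integral_ge0.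
apply: ge0_le_integralT => y1.
  by apply: integral_ge0 => x2 _; exact: integral_ge0.
have mfx : measurable_fun setT (fun x2 => f (x1, x2)).
  exact: (measurableT_comp mf (pair1_measurable x1)).
have mgy : measurable_fun setT (fun y2 => g (y1, y2)).
  exact: (measurableT_comp mg (pair1_measurable y1)).
have := hC x1 y1 (fun x2 => f (x1, x2)) (fun y2 => g (y1, y2)) mfx mgy.
move=> /(_ (fun _ => f0 _) (fun _ => g0 _)) H.
have kE0 : 0 <= (k1 (x1, y1))%:E by rewrite lee_fin.
have := lee_wpmul2l kE0 H.
rewrite /f1 /g1 /= muleCA [X in _ <= C2%:E * X]muleC; apply: le_trans.
have mq := measurable_powform s t (mh x1 y1) mfx mgy.
have q0 := powform_arg_ge0 s t (h0 x1 y1) (fun x2 => f (x1, x2)) (fun y2 => g (y1, y2)).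
rewrite /powform -ge0_integralZl//; first last.
- by move=> x _; apply: integral_ge0 => y _; exact: (q0 (x, y)).
- exact: (measurable_fun_fubini_tonelli_F _ mq).
apply: ge0_le_integralT => x2; first exact: integral_ge0.
rewrite -ge0_integralZl//; first last.
- by move=> y _; exact: (q0 (x2, y)).
- exact: (measurableT_comp mq (pair1_measurable x2)).
apply: ge0_le_integralT => y2; first exact: G0.
by rewrite /G /F /= KE EFinM muleCA.
Qed.

End Iteration.

(** * Recovering L^q bounds by duality *)

Section Duality.
Context d (T : measurableType d) (R : realType).
Variable m : {sigma_finite_measure set T -> \bar R}.
Local Open Scope ereal_scope.

(** Dividing by S^t absorbs the power on the right; a real [S] means that the quantity is already
    known to be finite. *)
Lemma powR_le_self (S A : R) (t : R) : (0 < t < 1)%R -> (0 <= S)%R -> (0 <= A)%R ->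
  (S <= A * S `^ t)%R -> (S <= A `^ (1 - t)^-1)%R.
Proof.
move=> /andP[t0 t1]; rewrite le_eqVlt => /predU1P[<-|S0] A0 SA.
  exact: powR_ge0.
have H : (S `^ (1 - t) <= A)%R.
  by rewrite powRB ?(gt_eqF S0) ?implybT// powRr1 ?(ltW S0)// ler_pdivrMr ?powR_gt0.
have e0 : (1 - t != 0)%R by rewrite gt_eqF// subr_gt0.
have -> : S = ((S `^ (1 - t)) `^ (1 - t)^-1)%R.
  by rewrite -powRrM mulfV// powRr1// ltW.
by rewrite ge0_ler_powR ?nnegrE ?powR_ge0// invr_ge0 subr_ge0 ltW.
Qed.

(** Testing with g = h^q, where q = 1/(1 - t), gives h g^t = h^q because 1 + q t = q. The integral
    of h^q is then at most [A] times its own t-th power. *)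
Theorem dual_power_bound (h : T -> \bar R) (t A : R) :
  (0 < t < 1)%R -> (0 <= A)%R ->
  measurable_fun setT h -> (forall x, 0 <= h x) ->
  (forall g : T -> \bar R, measurable_fun setT g -> (forall x, 0 <= g x) ->
    \int[m]_x (h x * g x `^ t) <= A%:E * (\int[m]_x g x) `^ t) ->
  \int[m]_x (h x `^ (1 - t)^-1) <= (A `^ (1 - t)^-1)%:E.
Proof.
move=> t01 A0 mh h0 H; set q := (1 - t)^-1%R.
have /andP[t0 t1] := t01.
have q0 : (0 < q)%R by rewrite invr_gt0 subr_gt0.
have /sigma_finiteP[E [ET ndE Eoo]] := sigma_finiteT m.
(* truncating in height and to a set of finite measure makes the q-th power
   integrable, so that it can be divided out *)
pose hN (N : nat) x : \bar R := Order.min (h x) N%:R%:E * (\1_(E N) x)%:E.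
pose gN N x := hN N x `^ q.
have mhN N : measurable_fun setT (hN N).
  apply: emeasurable_funM; first exact: measurable_mine.
  by apply/measurable_EFinP/measurable_indic; have [] := Eoo N.
have mgN N : measurable_fun setT (gN N).
  exact: (measurableT_comp (measurable_poweR q) (mhN N)).
have hN0 N x : 0 <= hN N x.
  by rewrite mule_ge0 ?lee_fin// le_min h0/= ?lee_fin.
have hNh N x : hN N x <= h x.
  rewrite /hN indicE; case: (_ \in _); rewrite ?mule0// mule1.
  by rewrite ge_min lexx.
have hNfin N x : hN N x \is a fin_num.
  rewrite fin_numM// ge0_fin_numE; last by rewrite le_min h0/= ?lee_fin.
  by rewrite gt_min ltry orbT.
have gN_bound M : \int[m]_x gN M x <= (A `^ q)%:E.
  have gNfin : \int[m]_x gN M x < +oo.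
    apply: (@le_lt_trans _ _ (\int[m]_x ((M%:R `^ q)%:E * (\1_(E M) x)%:E))).
      apply: ge0_le_integralT => x; first exact: poweR_ge0.
      rewrite /gN /hN indicE; case: (_ \in _).
        rewrite !mule1 -poweR_EFin gt0_ler_poweR ?(ltW q0)// ?ge_min ?lexx ?orbT//.
          by rewrite in_itv/= leey andbT le_min h0/= ?lee_fin.
        by rewrite in_itv/= leey andbT ?lee_fin.
      by rewrite !mule0 poweR0r// gt_eqF.
    have [mE Efin] := Eoo M.
    rewrite ge0_integralZl// ?lee_fin ?powR_ge0//.
      rewrite integral_indic// setIT lte_mul_pinfty// ?lee_fin ?powR_ge0//.
    by apply/measurable_EFinP/measurable_indic.
  have I0 : 0 <= \int[m]_x gN M x by apply: integral_ge0 => x _; exact: poweR_ge0.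
  have := H (gN M) (mgN M) (fun x => poweR_ge0 _ _).
  have If : \int[m]_x gN M x \is a fin_num by rewrite ge0_fin_numE.
  (* In the tested integral one factor [h] is left untruncated, and it dominates [hN M]. *)
  have le1 : \int[m]_x gN M x <= \int[m]_x (h x * gN M x `^ t).
    apply: ge0_le_integralT => x; first exact: poweR_ge0.
    apply: (@le_trans _ _ (hN M x * gN M x `^ t)); last first.
      by rewrite lee_wpmul2r ?poweR_ge0.
    rewrite /gN; have := hNfin M x; have := hN0 M x.
    case: (hN M x) => [a| |]//; rewrite lee_fin => a0 _.
    rewrite !poweR_EFin -EFinM lee_fin -powRrM.
    rewrite -{2}(powRr1 a0) -powRD; last first.
      by rewrite gt_eqF// addr_gt0// mulr_gt0.
    have -> : (1 + q * t = q)%R by rewrite /q; field; rewrite gt_eqF// subr_gt0.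
    by [].
  move=> /(le_trans le1); rewrite -(fineK If) poweR_EFin -EFinM !lee_fin => le2.
  by apply: powR_le_self => //; exact: fine_ge0.
have ndgN x : {homo gN ^~ x : n p / (n <= p)%N >-> n <= p}.
  move=> n p np; apply: gt0_ler_poweR; rewrite ?(ltW q0) ?in_itv/= ?hN0 ?leey//.
  apply: lee_pmul; rewrite ?lee_fin//.
  - by rewrite le_min h0/= ?lee_fin.
  - by rewrite le_min ge_min lexx/= ge_min lee_fin ler_nat np orbT.
  - rewrite !indicE; case: (boolP (x \in E n)) => //= /set_mem xE.
    by rewrite mem_set//; move/subsetPset: (ndE _ _ np); exact.
have limgN x : limn (gN ^~ x) = h x `^ q.
  have [n0 _ En0] : \forall n \near \oo, x \in E n.
    have : [set: T] x by []; rewrite ET => -[n _ Enx]; exists n => // p np.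
    by apply/mem_set; move/subsetPset: (ndE _ _ np); exact.
  have hNE n : (n0 <= n)%N -> gN n x = (Order.min (h x) n%:R%:E) `^ q.
    by move=> nn; rewrite /gN /hN indicE En0// mule1.
  have := h0 x; case hx : (h x) => [a| |]// a0.
    apply: lim_near_cst => //; exists (maxn n0 (Num.bound a)) => // n /=.
    rewrite geq_max => /andP[nn an]; rewrite hNE// hx.
    rewrite (_ : Order.min _ _ = a%:E)//; apply/min_idPl.
    rewrite lee_fin (le_trans (ltW (archi_boundP _)))//.
    by rewrite ler_nat.
  (* Where [h x] is infinite the truncation is eventually [n], whose q-th power tends to
     infinity. *)
  rewrite poweRyr ?gt_eqF//; apply/cvg_lim => //; apply/cvgeyPge => B.
  exists (maxn n0 (Num.bound (`|B| `^ q^-1)%R)) => // n /=.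
  rewrite geq_max => /andP[nn an]; rewrite hNE// hx.
  rewrite (_ : Order.min _ _ = n%:R%:E); last by apply/min_idPr; rewrite leey.
  rewrite poweR_EFin lee_fin (le_trans (ler_norm _))//.
  have -> : (`|B| = (`|B| `^ q^-1) `^ q)%R.
    by rewrite -powRrM mulVf ?gt_eqF// powRr1.
  rewrite ge0_ler_powR ?nnegrE ?powR_ge0 ?(ltW q0)//.
  rewrite (le_trans (ltW (archi_boundP _))) ?powR_ge0//.
  by rewrite ler_nat.
under eq_integral do rewrite -limgN.
rewrite monotone_convergence//; last by move=> n x _; exact: poweR_ge0.
apply: lime_le; last exact: nearW.
apply: ereal_nondecreasing_is_cvgn => n p np.
by apply: ge0_le_integralT => x; [exact: poweR_ge0|exact: ndgN].
Qed.

End Duality.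

(** * Measurability of the kernel and of the group law *)

Section HeisenbergKernel.
Context (R : realType) (n : nat).
Local Notation vec := (n.-tuple (measurableTypeR R)).
Local Notation hpoint := (vec * vec * measurableTypeR R)%type.

Lemma measurable_dotv d (T : measurableType d) (f g : T -> vec) :
  measurable_fun setT f -> measurable_fun setT g ->
  measurable_fun setT (fun x => dotv (f x) (g x)).
Proof.
move=> mf mg; apply: measurable_sum => i; apply: measurable_funM.
  exact: (measurableT_comp (measurable_tnth i) mf).
exact: (measurableT_comp (measurable_tnth i) mg).
Qed.

Lemma dotvv_ge0 (x : vec) : 0 <= dotv x x.
Proof. by apply: sumr_ge0 => i _; rewrite -expr2 sqr_ge0. Qed.

Lemma measurable_enorm d (T : measurableType d) (f : T -> vec) :
  measurable_fun setT f -> measurable_fun setT (fun x => enorm (f x)).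
Proof.
move=> mf.
rewrite (_ : (fun x => _) = (fun x => dotv (f x) (f x) `^ 2^-1)).
  exact/(measurableT_comp (measurable_powR 2^-1))/measurable_dotv.
by apply/funext => x; rewrite powR12_sqrt// dotvv_ge0.
Qed.

Lemma measurable_addv d (T : measurableType d) (f g : T -> vec) :
  measurable_fun setT f -> measurable_fun setT g ->
  measurable_fun setT (fun x => Defs.addv (f x) (g x)).
Proof.
move=> mf mg; apply/measurable_fun_tnthP => i.
rewrite (_ : _ \o _ = (fun x => tnth (f x) i + tnth (g x) i)); last first.
  by apply/funext => x /=; rewrite tnth_mktuple.
apply: measurable_funD.
  exact: (measurableT_comp (measurable_tnth i) mf).
exact: (measurableT_comp (measurable_tnth i) mg).
Qed.

Lemma measurable_oppv d (T : measurableType d) (f : T -> vec) :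
  measurable_fun setT f -> measurable_fun setT (fun x => oppv (f x)).
Proof.
move=> mf; apply/measurable_fun_tnthP => i.
rewrite (_ : _ \o _ = (fun x => - tnth (f x) i)); last first.
  by apply/funext => x /=; rewrite tnth_mktuple.
apply: measurableT_comp => //.
exact: (measurableT_comp (measurable_tnth i) mf).
Qed.

Lemma measurable_fun_eq0 d (T : measurableType d) (f : T -> R) :
  measurable_fun setT f -> measurable_fun setT (fun x => f x == 0).
Proof. by move=> mf; apply: (measurable_fun_eqr mf); exact: measurable_cst. Qed.

Lemma measurable_powRr d (T : measurableType d) (f : T -> R) (e : R) :
  measurable_fun setT f -> measurable_fun setT (fun x => f x `^ e).
Proof. exact: (measurableT_comp (measurable_powR e)). Qed.

Lemma measurable_hkernel (al be : R) :
  measurable_fun setT (@hkernel R n al be).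
Proof.
rewrite (_ : hkernel al be = fun x : hpoint =>
   let a := enorm x.1.1 in let b := enorm x.1.2 in let c := `|x.2 : R| in
  if [|| a == 0, b == 0 | c == 0] then 0
  else a `^ (al - n%:R) * b `^ (al - n%:R) * c `^ (be - 1) *
       (a * b / c + c / (a * b)) `^ (- (`|al - n%:R * be| / n.+1%:R))); last first.
  by apply/funext => -[[]].
have ma : measurable_fun setT (fun x : hpoint => enorm x.1.1).
  apply: measurable_enorm.
  exact: (measurableT_comp measurable_fst measurable_fst).
have mb : measurable_fun setT (fun x : hpoint => enorm x.1.2).
  apply: measurable_enorm.
  exact: (measurableT_comp measurable_snd measurable_fst).
have mc : measurable_fun setT (fun x : hpoint => `|x.2 : R|).
  exact: (measurableT_comp (@normr_measurable R setT) measurable_snd).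
(* The inverse of a nonnegative number is its power -1, also at 0 where both are 0, so measurability
   of powers applies. *)
have mV (f : hpoint -> R) : (forall x, 0 <= f x) -> measurable_fun setT f ->
    measurable_fun setT (fun x => (f x)^-1).
  move=> f0 mf; under eq_fun do rewrite -powR_inv1//.
  exact: measurable_powRr.
apply: measurable_fun_ifT => /=.
- by apply: measurable_or; [|apply: measurable_or]; exact: measurable_fun_eq0.
- exact: measurable_cst.
have mab := measurable_funM ma mb.
apply: measurable_funM.
  by apply: measurable_funM; first apply: measurable_funM; exact: measurable_powRr.
apply: measurable_powRr; apply: measurable_funD.
  by apply: measurable_funM => //; apply: mV => // x; exact: normr_ge0.
by apply: measurable_funM => //; apply: mV => // x; rewrite mulr_ge0// sqrtr_ge0.
Qed.

Lemma measurable_hmul_hinv (mu : R) :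
  measurable_fun setT (fun z : hpoint * hpoint => hmul mu z.1 (hinv z.2)).
Proof.
rewrite (_ : (fun z => _) = fun z : hpoint * hpoint =>
  (Defs.addv z.1.1.1 (oppv z.2.1.1), Defs.addv z.1.1.2 (oppv z.2.1.2),
   (z.1.2 + (- z.2.2) + mu * (dotv z.1.1.1 (oppv z.2.1.2) -
     dotv z.1.1.2 (oppv z.2.1.1))) : measurableTypeR R)); last first.
  by apply/funext => -[[[? ?] ?] [[? ?] ?]].
have m1 : measurable_fun setT (fun z : hpoint * hpoint => z.1.1.1).
  by do 2!apply: (measurableT_comp measurable_fst) => //.
have m2 : measurable_fun setT (fun z : hpoint * hpoint => z.1.1.2).
  by apply: (measurableT_comp measurable_snd); apply: (measurableT_comp measurable_fst).
have m3 : measurable_fun setT (fun z : hpoint * hpoint => z.1.2 : R).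
  exact: (measurableT_comp measurable_snd).
have m4 : measurable_fun setT (fun z : hpoint * hpoint => z.2.1.1).
  by do 2!apply: (measurableT_comp measurable_fst) => //.
have m5 : measurable_fun setT (fun z : hpoint * hpoint => z.2.1.2).
  by apply: (measurableT_comp measurable_snd); apply: (measurableT_comp measurable_fst).
have m6 : measurable_fun setT (fun z : hpoint * hpoint => z.2.2 : R).
  exact: (measurableT_comp measurable_snd).
apply: measurable_fun_pair; first apply: measurable_fun_pair.
- by apply: measurable_addv => //; exact: measurable_oppv.
- by apply: measurable_addv => //; exact: measurable_oppv.
apply: measurable_funD.
  by apply: measurable_funD => //; exact: measurableT_comp.
apply: measurable_funM => //; apply: measurable_funB.
  by apply: measurable_dotv => //; exact: measurable_oppv.
by apply: measurable_dotv => //; exact: measurable_oppv.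
Qed.

End HeisenbergKernel.

(** * Riesz kernels on R^n and on the line *)

Section RieszKernels.
Context (R : realType).

Lemma powR_gt_ball (a t e : R) : 0 < t -> 0 <= a -> e < 0 ->
  t < a `^ e -> a < t `^ e^-1.
Proof.
move=> t0; rewrite le_eqVlt => /predU1P[<- e0|a0 e0 tae].
  by rewrite powR_gt0.
rewrite ltNge; apply/negP => taE.
have : a `^ e <= (t `^ e^-1) `^ e.
  rewrite -[e]opprK (powRN a) (powRN (t `^ _)) lef_pV2 ?posrE ?powR_gt0//.
  by rewrite ge0_ler_powR ?nnegrE ?powR_ge0 ?oppr_ge0 ?(ltW e0) ?(ltW a0)// opprK.
rewrite -powRrM mulVf ?lt_eqF// powRr1 ?(ltW t0)// leNgt => /negP; exact.
Qed.

Variable n : nat.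
Local Notation vec := (n.-tuple (measurableTypeR R)).

(** This encloses Euclidean balls in cubes, whose measure is the product of the side lengths. *)
Lemma dist_coord_le (x y : vec) i :
  `|tnth x i - tnth y i : R| <= enorm (Defs.addv x (oppv y)).
Proof.
rewrite -sqrtr_sqr ler_sqrt ?dotvv_ge0// /dotv (bigD1 i)//= !tnth_mktuple -expr2.
by rewrite lerDl sumr_ge0// => j _; rewrite -expr2 sqr_ge0.
Qed.

Lemma enorm_subC (x y : vec) :
  enorm (Defs.addv x (oppv y)) = enorm (Defs.addv y (oppv x)).
Proof.
congr Num.sqrt; apply: eq_bigr => i _; rewrite !tnth_mktuple.
by ring.
Qed.

Lemma lebesgue_tuple_cube (x : vec) (r : R) : 0 <= r ->
  lebesgue_tuple R n [set y | forall i, ball (tnth x i : R) r (tnth y i)] =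
  ((2 * r) ^+ n)%:E.
Proof.
move=> r0; rewrite (lebesgue_tuple_box (A := fun i => ball (tnth x i : R) r)).
  rewrite (eq_bigr (fun=> (2 * r)%:E)) => [|i _].
    by rewrite prodEFin prodr_const card_ord.
  by rewrite lebesgue_measure_ball// mulr2n mulrDl mul1r.
by move=> i; exact: measurable_ball.
Qed.

(** For nonzero [e] the value on the diagonal is 0, by the convention on powers of 0. *)
Definition riesz (e : R) (z : vec * vec) : R :=
  enorm (Defs.addv z.1 (oppv z.2)) `^ e.

Lemma measurable_riesz e : measurable_fun setT (riesz e).
Proof.
apply: measurable_powRr; apply: measurable_enorm; apply: measurable_addv => //.
exact: measurable_oppv.
Qed.

Lemma riesz_ge0 e z : 0 <= riesz e z. Proof. exact: powR_ge0. Qed.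

(** The exponent is negative, so a superlevel set lies in a ball of radius t^(1/(n(s - 1))), hence
    in a cube of twice that side, whose volume is 2^n t^(-1/(1 - s)). *)
Lemma weak_type_riesz (s : R) (x : vec) : (0 < n)%N -> s < 1 ->
  weak_type (lebesgue_tuple R n) (fun y => riesz (n%:R * (s - 1)) (x, y))
    (2 ^+ n) (1 - s)^-1.
Proof.
move=> n0 s1 t t0; have nR : 0 < n%:R :> R by rewrite ltr0n.
have e0 : n%:R * (s - 1) < 0 by rewrite pmulr_rlt0// subr_lt0.
pose r := t `^ (n%:R * (s - 1))^-1.
have -> : (2 ^+ n * t `^ (- (1 - s)^-1))%:E =
    lebesgue_tuple R n [set y | forall i, ball (tnth x i : R) r (tnth y i)].
  rewrite lebesgue_tuple_cube ?powR_ge0// exprMn -[r ^+ n]powR_mulrn ?powR_ge0//.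
  rewrite /r -powRrM; congr ((_ * (_ `^ _))%:E).
  by field; rewrite !subr_eq0 (gt_eqF s1) (lt_eqF s1) (gt_eqF nR).
apply: le_measure; rewrite ?inE.
- rewrite (_ : superlevel _ _ = (fun y => riesz (n%:R * (s - 1)) (x, y)) @^-1` `]t, +oo[).
    rewrite -[X in measurable X]setTI.
    by apply: (measurableT_comp (@measurable_riesz _) (pair1_measurable x)).
  by apply/seteqP; split => y /=; rewrite in_itv/= andbT.
- rewrite (_ : [set y | _] = \bigcap_(i in [set: 'I_n])
      ((@tnth _ _)^~ i @^-1` ball (tnth x i : R) r)).
    apply: fin_bigcap_measurable => // i _.
    rewrite -[X in measurable X]setTI.
    by apply: measurable_tnth => //; exact: measurable_ball.
  by apply/seteqP; split => [y Ay i _|y Ay i]; exact: Ay.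
move=> y /= ty i; rewrite /ball/=; apply: le_lt_trans (dist_coord_le x y i) _.
by apply: powR_gt_ball ty => //; exact: sqrtr_ge0.
Qed.

(** With s = 1 - 1/q and t = 1/p, the number s + t - 1 is 1/p - 1/q, so the exponent is that of the
    product kernel. The kernel is symmetric, and one weak-type estimate serves both variables. *)
Theorem riesz_powform_bounded (s t : R) : (0 < n)%N ->
  0 < s < 1 -> 0 < t < 1 -> 1 < s + t ->
  powform_bounded (lebesgue_tuple R n) (lebesgue_tuple R n)
    (riesz (n%:R * (s + t - 1 - 1))) s t
    (hls_const s t (2 ^+ n) + hls_const t s (2 ^+ n)).
Proof.
move=> n0 s01 t01 st; have st2 : s + t - 1 < 1.
  by move: s01 t01 => /andP[? ?] /andP[? ?]; lra.
have rE : 2 - s - t = 1 - (s + t - 1) by ring.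
apply: weak_type_powform_bounded => //.
- exact: measurable_riesz.
- exact: riesz_ge0.
- by move=> x; rewrite rE; exact: weak_type_riesz.
- move=> y; rewrite rE; have := weak_type_riesz y n0 st2.
  by under eq_fun do rewrite /riesz /= enorm_subC.
Qed.

(** The shift [c] stands for the group twist once the horizontal variables are frozen. *)
Definition riesz1 (c e : R) (z : measurableTypeR R * measurableTypeR R) : R :=
  `|(z.1 : R) - z.2 + c| `^ e.

Lemma measurable_riesz1 c e : measurable_fun setT (riesz1 c e).
Proof.
apply: measurable_powRr; apply: measurableT_comp => //.
by apply: measurable_funD => //; exact: measurable_funB.
Qed.

Lemma riesz1_ge0 c e z : 0 <= riesz1 c e z. Proof. exact: powR_ge0. Qed.

Lemma weak_type_riesz1 (f : measurableTypeR R -> R) (s c : R) : s < 1 ->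
  measurable_fun setT f -> (forall y, f y = `|c - y : R| `^ (s - 1)) ->
  weak_type (@lebesgue_measure R) f 2 (1 - s)^-1.
Proof.
move=> s1 mf fE t t0; have e0 : s - 1 < 0 by rewrite subr_lt0.
pose r := t `^ (s - 1)^-1.
have -> : (2 * t `^ (- (1 - s)^-1))%:E = lebesgue_measure (ball c r).
  rewrite lebesgue_measure_ball ?powR_ge0// mulr_natl /r.
  by rewrite -invrN opprB.
apply: le_measure; rewrite ?inE.
- rewrite (_ : superlevel _ _ = f @^-1` `]t, +oo[).
    by rewrite -[X in measurable X]setTI; exact: mf.
  by apply/seteqP; split => y /=; rewrite in_itv/= andbT.
- exact: measurable_ball.
move=> y /=; rewrite /superlevel/= fE => ty; rewrite /ball/=.
exact: powR_gt_ball ty.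
Qed.

(** The shift only moves the centres of the intervals containing the superlevel sets, so the
    constant is independent of [c]. *)
Theorem riesz1_powform_bounded (c s t : R) :
  0 < s < 1 -> 0 < t < 1 -> 1 < s + t ->
  powform_bounded (@lebesgue_measure R) (@lebesgue_measure R)
    (riesz1 c (s + t - 1 - 1)) s t (hls_const s t 2 + hls_const t s 2).
Proof.
move=> s01 t01 st; have st2 : s + t - 1 < 1.
  by move: s01 t01 => /andP[? ?] /andP[? ?]; lra.
have rE : 2 - s - t = 1 - (s + t - 1) by ring.
apply: weak_type_powform_bounded => //.
- exact: measurable_riesz1.
- exact: riesz1_ge0.
- move=> x; rewrite rE; apply: (@weak_type_riesz1 _ _ (x + c)) => //.
    exact: (measurableT_comp (measurable_riesz1 c _) (pair1_measurable x)).
  by move=> y; rewrite /riesz1/=; congr (`| _ | `^ _); ring.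
- move=> y; rewrite rE; apply: (@weak_type_riesz1 _ _ (y - c)) => //.
    exact: (measurableT_comp (measurable_riesz1 c _) (pair2_measurable y)).
  by move=> x; rewrite /riesz1/= -normrN; congr (`| _ | `^ _); ring.
Qed.

End RieszKernels.

(** * Domination by the product kernel and its bound *)

Section Sufficiency.
Context (R : realType) (n : nat).
Local Notation vec := (n.-tuple (measurableTypeR R)).
Local Notation hpoint := (vec * vec * measurableTypeR R)%type.
Local Notation lt := (lebesgue_tuple R n).

(* With w = ab/c, the kernel is the product kernel times
   w^d (w + 1/w)^(-|d|), which is at most 1. *)
Lemma hkernel_le (s d : R) (z : hpoint) :
  hkernel (n%:R * s + d) (s - d) z <=
  enorm z.1.1 `^ (n%:R * (s - 1)) * enorm z.1.2 `^ (n%:R * (s - 1)) *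
    `|z.2 : R| `^ (s - 1).
Proof.
case: z => -[xi eta] tau /=; rewrite /hkernel.
set a := enorm xi; set b := enorm eta; set c := `|_|.
have [a0 b0 c0] : [/\ 0 <= a, 0 <= b & 0 <= c] by rewrite !sqrtr_ge0 normr_ge0.
case: ifPn => [_|]; first by rewrite !mulr_ge0 ?powR_ge0.
rewrite !negb_or => /and3P[aN bN cN].
have {}a0 : 0 < a by rewrite lt_def aN.
have {}b0 : 0 < b by rewrite lt_def bN.
have {}c0 : 0 < c by rewrite lt_def cN.
have nE : n.+1%:R = n%:R + 1 :> R by rewrite -natr1.
(* Here alpha - n beta equals (n + 1) d, so the bracket carries exactly the exponent -|d|. *)
have -> : `|n%:R * s + d - n%:R * (s - d)| / n.+1%:R = `|d|.
  rewrite (_ : _ - _ = d * n.+1%:R); last by rewrite nE; ring.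
  by rewrite normrM (ger0_norm (ler0n _ n.+1)) mulfK// pnatr_eq0.
rewrite -[c / (a * b)]invf_div; set w := a * b / c.
have w0 : 0 < w by rewrite divr_gt0// mulr_gt0.
have wd : w `^ d = a `^ d * b `^ d * c `^ (- d).
  rewrite powRM ?invr_ge0 ?mulr_ge0 ?ltW// powRM ?ltW// -(powR_inv1 (ltW c0)).
  by rewrite -powRrM mulN1r.
have dE x (x0 : 0 < x) e1 e2 : x `^ (e1 + e2) = x `^ e1 * x `^ e2 :> R.
  by rewrite powRD// (gt_eqF x0) implybT.
rewrite (_ : n%:R * s + d - n%:R = n%:R * (s - 1) + d); last by ring.
rewrite (_ : s - d - 1 = s - 1 - d); last by ring.
rewrite (dE a)// (dE b)// (dE c c0 (s - 1) (- d)).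
set A := a `^ (_ * _); set B := b `^ (_ * _); set D := c `^ (s - 1).
rewrite [leLHS](_ : _ = A * B * D * (w `^ d * (w + w^-1) `^ (- `|d|))); last first.
  by rewrite wd; ring.
rewrite ler_piMr ?mulr_ge0 ?powR_ge0//.
rewrite powRN ler_pdivrMr ?powR_gt0 ?addr_gt0 ?invr_gt0// mul1r.
(* Both w and 1/w are at most w + 1/w; the sign of [d] decides which of them is raised to the power
   |d|. *)
case: (ger0P d) => d0.
  rewrite ge0_ler_powR ?nnegrE ?addr_ge0 ?invr_ge0 ?(ltW w0)//.
  by rewrite lerDl invr_ge0 ltW.
have -> : w `^ d = w^-1 `^ (- d).
  by rewrite -[w^-1]powR_inv1 ?(ltW w0)// -powRrM mulN1r opprK.
rewrite ge0_ler_powR ?nnegrE ?addr_ge0 ?invr_ge0 ?(ltW w0) ?oppr_ge0 ?(ltW d0)//.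
by rewrite lerDr ltW.
Qed.

Variables (mu s t : R).

Definition product_kernel (z : hpoint * hpoint) : R :=
  let p := hmul mu z.1 (hinv z.2) in
  riesz (n%:R * (s + t - 1 - 1)) (z.1.1.1, z.2.1.1) *
  riesz (n%:R * (s + t - 1 - 1)) (z.1.1.2, z.2.1.2) *
  `|p.2 : R| `^ (s + t - 1 - 1).

Lemma measurable_product_kernel : measurable_fun setT product_kernel.
Proof.
have m1 : measurable_fun setT (fun z : hpoint * hpoint => z.1.1.1).
  by do 2!apply: (measurableT_comp measurable_fst) => //.
have m2 : measurable_fun setT (fun z : hpoint * hpoint => z.1.1.2).
  by apply: (measurableT_comp measurable_snd); apply: (measurableT_comp measurable_fst).
have m4 : measurable_fun setT (fun z : hpoint * hpoint => z.2.1.1).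
  by do 2!apply: (measurableT_comp measurable_fst) => //.
have m5 : measurable_fun setT (fun z : hpoint * hpoint => z.2.1.2).
  by apply: (measurableT_comp measurable_snd); apply: (measurableT_comp measurable_fst).
apply: measurable_funM; first apply: measurable_funM.
- by apply: (measurableT_comp (measurable_riesz _)); exact: measurable_fun_pair.
- by apply: (measurableT_comp (measurable_riesz _)); exact: measurable_fun_pair.
- apply: measurable_powRr; apply: measurableT_comp => //.
  by apply: (measurableT_comp measurable_snd); exact: measurable_hmul_hinv.
Qed.

Definition hfrac_const : R :=
  (hls_const s t (2 ^+ n) + hls_const t s (2 ^+ n)) *
  (hls_const s t (2 ^+ n) + hls_const t s (2 ^+ n)) *
  (hls_const s t 2 + hls_const t s 2).

Lemma hfrac_const_gt0 : 0 < s < 1 -> 0 < t < 1 -> 1 < s + t -> 0 < hfrac_const.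
Proof.
move=> s01 t01 st; have ts : 1 < t + s by rewrite addrC.
by rewrite !mulr_gt0// addr_gt0// hls_const_gt0// exprn_ge0.
Qed.

(** The inner use of [powform_bounded_prod] couples the two copies of R^n; the outer one adds the
    last variable, whose kernel is a shifted [riesz1] with a constant uniform in the shift. *)
Theorem product_kernel_powform_bounded : (0 < n)%N ->
  0 < s < 1 -> 0 < t < 1 -> 1 < s + t ->
  powform_bounded
    (sigma_finite_product (sigma_finite_product lt lt) (@lebesgue_measure R))
    (sigma_finite_product (sigma_finite_product lt lt) (@lebesgue_measure R))
    product_kernel s t hfrac_const.
Proof.
move=> n0 s01 t01 st; have ts : 1 < t + s by rewrite addrC.
have C0 A : 0 <= A -> 0 <= hls_const s t A + hls_const t s A.
  by move=> A0; rewrite ltW// addr_gt0 ?hls_const_gt0.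
apply: (powform_bounded_prod (k1 := fun z => riesz (n%:R * (s + t - 1 - 1)) (z.1.1, z.2.1) *
    riesz (n%:R * (s + t - 1 - 1)) (z.1.2, z.2.2))
  (h := fun x y => riesz1 (mu * (dotv x.1 (oppv y.2) - dotv x.2 (oppv y.1)))
    (s + t - 1 - 1))).
- exact: C0.
- apply: measurable_funM; apply: (measurableT_comp (measurable_riesz _)).
    by apply: measurable_fun_pair; apply: (measurableT_comp measurable_fst).
  by apply: measurable_fun_pair; apply: (measurableT_comp measurable_snd).
- by move=> z; rewrite mulr_ge0 ?riesz_ge0.
- by move=> x y; exact: measurable_riesz1.
- by move=> x y z; exact: riesz1_ge0.
- exact: measurable_product_kernel.
- by move=> [u v] x2 [xi eta] y2.
- apply: (powform_bounded_prod (k1 := riesz (n%:R * (s + t - 1 - 1)))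
    (h := fun x y => riesz (n%:R * (s + t - 1 - 1)))).
  + by apply: C0; rewrite exprn_ge0.
  + exact: measurable_riesz.
  + exact: riesz_ge0.
  + by move=> _ _; exact: measurable_riesz.
  + by move=> _ _; exact: riesz_ge0.
  + apply: measurable_funM; apply: (measurableT_comp (measurable_riesz _)).
      by apply: measurable_fun_pair; apply: (measurableT_comp measurable_fst).
    by apply: measurable_fun_pair; apply: (measurableT_comp measurable_snd).
  + by [].
  + exact: riesz_powform_bounded.
  + by move=> _ _; exact: riesz_powform_bounded.
- by move=> x y; exact: riesz1_powform_bounded.
Qed.

End Sufficiency.

(** * Sufficiency of the homogeneity condition *)

(** With s = 1 - 1/q and t = 1/p these are the hypotheses of the form bounds; the last one expresses
    p < q. *)
Lemma dual_exponents (R : realFieldType) (p q : R) : 1 < p -> p < q ->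
  [/\ 0 < 1 - q^-1 < 1, 0 < p^-1 < 1 & 1 < 1 - q^-1 + p^-1].
Proof.
move=> p1 pq; have p0 : 0 < p by exact: lt_trans p1.
have q0 : 0 < q by exact: lt_trans pq.
have qp : q^-1 < p^-1 by rewrite ltf_pV2.
split; last lra.
  by rewrite subr_gt0 invf_lt1// (lt_trans p1 pq)/= gtrBl invr_gt0.
by rewrite invr_gt0 p0 invf_lt1.
Qed.

Section HFracInt.
Context (R : realType) (n : nat) (mu al be : R).
Local Notation vec := (n.-tuple (measurableTypeR R)).
Local Notation hpoint := (vec * vec * measurableTypeR R)%type.
Local Notation hleb := (hlebesgue R n).
Local Notation shleb := (sigma_finite_product
  (sigma_finite_product (lebesgue_tuple R n) (lebesgue_tuple R n))
  (@lebesgue_measure R)).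

Lemma hkernel_ge0 (z : hpoint) : 0 <= hkernel al be z.
Proof.
by case: z => -[xi eta] tau; rewrite /hkernel; case: ifP => // _;
  rewrite !mulr_ge0 ?powR_ge0.
Qed.

Lemma Lfun_measurable (p : \bar R) (f : hpoint -> R) :
  f \in Lfun hleb p -> measurable_fun setT f.
Proof. by move/sub_Lfun_mfun; rewrite inE. Qed.

Lemma Lfun_Lnorm_lty (p : \bar R) (f : hpoint -> R) :
  f \in Lfun hleb p -> ('N[hleb]_p[EFin \o f] < +oo)%E.
Proof. by move/sub_Lfun_finLfun; rewrite inE. Qed.

Lemma measurable_hintegrand (f : hpoint -> R) : measurable_fun setT f ->
  measurable_fun setT (fun z : hpoint * hpoint => hintegrand mu al be f z.1 z.2).
Proof.
move=> mf; apply/measurable_EFinP/measurable_funM.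
  exact: (measurableT_comp mf).
exact: (measurableT_comp (measurable_hkernel _ _) (measurable_hmul_hinv mu)).
Qed.

(** The work is done on [h], the operator applied to |f|. Duality with the product form bounds its
    L^q norm, its finiteness almost everywhere gives absolute convergence, and it dominates the
    absolute value of [hfracint]. *)
Theorem hfracint_bounded_suff (p q : R) : (0 < n)%N -> 1 < p -> p < q ->
  (al + be) / n.+1%:R = 1 / p - 1 / q ->
  hfracint_bounded n mu al be p q (hfrac_const n (1 - q^-1) p^-1).
Proof.
move=> n0 p1 pq; rewrite !div1r => ab f fL.
have p0 : 0 < p by exact: lt_trans p1.
have q0 : 0 < q by exact: lt_trans pq.
have mf := Lfun_measurable fL; have Np := Lfun_Lnorm_lty fL.
pose s := 1 - q^-1; pose t := p^-1.
have [s01 t01 st] : [/\ 0 < s < 1, 0 < t < 1 & 1 < s + t].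
  exact: dual_exponents.
pose sg := p^-1 - q^-1.
have sgE : sg = s + t - 1 by rewrite /sg /s /t; ring.
(* The homogeneity condition leaves one free parameter; this choice gives [al] and [be] the shape
   required by [hkernel_le]. *)
pose dl := sg - be.
have nN : n.+1%:R != 0 :> R by rewrite pnatr_eq0.
have alE : al = n%:R * sg + dl.
  have : al + be = sg * n.+1%:R by rewrite /sg -ab divfK.
  by rewrite -natr1 /dl => H; rewrite -(addrK be al) H; ring.
have beE : be = sg - dl by rewrite /dl; ring.
pose a y := ((`|f y| `^ p)%:E : \bar R).
have ma : measurable_fun setT a.
  by apply/measurable_EFinP/measurable_powRr; exact: measurableT_comp.
pose f1 y := `|f y|.
have mf1 : measurable_fun setT f1 by exact: measurableT_comp.
pose h x := (\int[hleb]_y hintegrand mu al be f1 x y)%E.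
have mi := measurable_hintegrand mf; have mi1 := measurable_hintegrand mf1.
have i10 z : (0 <= hintegrand mu al be f1 z.1 z.2)%E.
  by rewrite lee_fin mulr_ge0 ?hkernel_ge0 ?normr_ge0.
have mh : measurable_fun setT h.
  exact: (measurable_fun_fubini_tonelli_F (m2 := shleb) _ mi1 i10).
have h0 x : (0 <= h x)%E by apply: integral_ge0 => y _; exact: (i10 (x, y)).
have NE : ('N[hleb]_p%:E[EFin \o f] = (\int[hleb]_y a y) `^ t)%E.
  by rewrite unlock.
have Nfin : ('N[hleb]_p%:E[EFin \o f] \is a fin_num)%E.
  by rewrite ge0_fin_numE ?Lnorm_ge0.
set C := hfrac_const n _ _.
have C0 : 0 <= C by rewrite ltW// hfrac_const_gt0.
pose A := C * fine ('N[hleb]_p%:E[EFin \o f])%E.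
have A0 : 0 <= A by rewrite mulr_ge0// fine_ge0// Lnorm_ge0.
have AE : A%:E = (C%:E * 'N[hleb]_p%:E[EFin \o f])%E by rewrite EFinM fineK.
have hq : (\int[shleb]_x (h x `^ q) <= (A `^ q)%:E)%E.
  have qE : q = (1 - s)^-1 by rewrite /s subKr invrK.
  rewrite {1 2}qE; apply: (dual_power_bound s01 A0 mh h0) => g mg g0.
  rewrite AE NE -muleA [X in (_ <= _ * X)%E]muleC.
  have := product_kernel_powform_bounded mu n0 s01 t01 st mg ma g0.
  move=> /(_ (fun y => _)) H; apply: le_trans (H _); last first.
    by move=> y; rewrite lee_fin powR_ge0.
  apply: ge0_le_integralT => x; first by rewrite mule_ge0 ?poweR_ge0.
  rewrite muleC -ge0_integralZl ?poweR_ge0//; first last.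
  - by move=> y _; exact: (i10 (x, y)).
  - exact: (measurableT_comp mi1 (pair1_measurable x)).
  apply: ge0_le_integralT => y; first by rewrite mule_ge0 ?poweR_ge0// (i10 (x, y)).
  rewrite -muleA lee_wpmul2l ?poweR_ge0// /a /= -powRrM mulfV ?gt_eqF//.
  rewrite powRr1// -EFinM /hintegrand lee_fin ler_wpM2l ?normr_ge0//.
  rewrite alE [X in hkernel _ X]beE.
  apply: le_trans (hkernel_le sg dl _) _.
  by rewrite sgE; move: x y => [[? ?] ?] [[? ?] ?].
have Ih x : (`|hfracint mu al be f x| <= h x)%E.
  apply: le_trans (le_abse_integral hleb measurableT _) _.
    exact: (measurableT_comp mi (pair1_measurable x)).
  apply: ge0_le_integralT => y; first exact: abse_ge0.
  by rewrite /= lee_fin normrM (ger0_norm (hkernel_ge0 _)).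
have mhq : measurable_fun setT (fun x => h x `^ q)%E.
  exact: (measurableT_comp (measurable_poweR q) mh).
split.
  (* Integrability of h^q makes [h x] finite for almost every [x], and finiteness of [h x] is
     absolute convergence at [x]. *)
  have /integrable_ae : hleb.-integrable setT (fun x => h x `^ q)%E.
    apply/integrableP; split => //.
    under eq_integral do rewrite gee0_abs ?poweR_ge0//.
    by apply: le_lt_trans hq _; rewrite ltry.
  move=> /(_ measurableT); apply: filterS => x /= /(_ Logic.I) hfin.
  apply/integrableP; split.
    exact: (measurableT_comp mi (pair1_measurable x)).
  have : (h x < +oo)%E.
    by apply: (@lty_poweRy _ _ q); rewrite ?gt_eqF// ltey_eq hfin.
  apply: le_lt_trans; apply: ge0_le_integralT => y; first exact: abse_ge0.
  by rewrite /= lee_fin normrM (ger0_norm (hkernel_ge0 _)).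
rewrite -AE unlock.
have -> : A%:E = ((A `^ q)%:E `^ q^-1)%E.
  by rewrite poweR_EFin -powRrM mulfV ?gt_eqF// powRr1.
apply: gt0_ler_poweR; rewrite ?invr_ge0 ?(ltW q0)// ?in_itv/= ?leey ?andbT.
- by apply: integral_ge0 => x _; exact: poweR_ge0.
- by rewrite lee_fin powR_ge0.
apply: le_trans hq; apply: ge0_le_integralT => x; first exact: poweR_ge0.
by apply: gt0_ler_poweR; rewrite ?(ltW q0)// ?in_itv/= ?leey ?andbT ?abse_ge0.
Qed.

End HFracInt.

(** * Necessity of the homogeneity condition *)

Section Necessity.
Context (R : realType) (n : nat) (mu al be : R).
Local Notation vec := (n.-tuple (measurableTypeR R)).
Local Notation hpoint := (vec * vec * measurableTypeR R)%type.
Local Notation hleb := (hlebesgue R n).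

Definition vbox (l h : R) : set vec := [set x | forall i, `[l, h]%classic (tnth x i : R)].

Definition hbox (l h l' h' : R) : set hpoint :=
  (vbox l h `*` vbox l h) `*` (`[l', h']%classic : set R).

Lemma measurable_vbox l h : measurable (vbox l h).
Proof.
rewrite (_ : vbox l h =
    \bigcap_(i in [set: 'I_n]) ((@tnth _ _)^~ i @^-1` `[l, h]%classic)).
  apply: fin_bigcap_measurable => // i _.
  by rewrite -[X in measurable X]setTI; apply: measurable_tnth.
by apply/seteqP; split => [y Ay i _|y Ay i]; exact: Ay.
Qed.

Lemma measurable_hbox l h l' h' : measurable (hbox l h l' h').
Proof.
by apply: measurableX => //; apply: measurableX; exact: measurable_vbox.
Qed.

Lemma lebesgue_itvcc (l h : R) : l <= h ->
  @lebesgue_measure R `[l, h]%classic = (h - l)%:E.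
Proof.
rewrite lebesgue_measure_itv/= lte_fin le_eqVlt => /predU1P[->|->] //.
by rewrite ltxx subrr.
Qed.

Lemma hlebesgue_hbox l h l' h' : l <= h -> l' <= h' ->
  hleb (hbox l h l' h') = ((h - l) ^+ (2 * n) * (h' - l'))%:E.
Proof.
move=> lh lh'.
have vE : lebesgue_tuple R n (vbox l h) = ((h - l) ^+ n)%:E.
  rewrite (lebesgue_tuple_box (A := fun=> `[l, h]%classic))//.
  rewrite (eq_bigr (fun=> (h - l)%:E)) => [|i _]; last exact: lebesgue_itvcc.
  by rewrite prodEFin prodr_const card_ord.
have mv := measurable_vbox l h.
rewrite /hlebesgue [LHS]product_measure1E//; last exact: measurableX.
rewrite [X in (X * _)%E]product_measure1E// [X in (_ * X)%E]lebesgue_itvcc//.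
transitivity (((h - l) ^+ n)%:E * ((h - l) ^+ n)%:E * (h' - l')%:E)%E.
  by congr (_ * _ * _)%E; exact: vE.
by rewrite -!EFinM mulSn mul1n exprD.
Qed.

(** The ratio x / L lies in [1, D], and the exponent -|e| covers both signs of [e]. *)
Lemma powR_scale_ge (x e L D : R) : 0 < L -> 1 <= D -> L <= x <= D * L ->
  D `^ (- `|e|) * L `^ e <= x `^ e.
Proof.
move=> L0 D1 /andP[Lx xL].
have y1 : 1 <= x / L by rewrite ler_pdivlMr// mul1r.
have yD : x / L <= D by rewrite ler_pdivrMr.
have -> : x = x / L * L by rewrite divfK// gt_eqF.
rewrite powRM ?ler_wpM2r ?powR_ge0// ?(ltW L0)//; last first.
  by rewrite (le_trans ler01).
apply: (@le_trans _ _ ((x / L) `^ (- `|e|))).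
  rewrite !powRN lef_pV2 ?posrE ?powR_gt0 ?(lt_le_trans ltr01)//.
  by rewrite ge0_ler_powR ?nnegrE// (le_trans ler01).
by apply: ler_powR => //; rewrite lerNl -normrN ler_norm.
Qed.

Lemma enorm_box (L : R) (x : vec) : (0 < n)%N -> 0 < L ->
  (forall i, L <= (tnth x i : R) <= 3 * L) -> L <= enorm x <= 3 * n%:R * L.
Proof.
move=> n0 L0 Lx; have nR : 1 <= n%:R :> R by rewrite ler1n.
apply/andP; split.
  apply: (@le_trans _ _ `|tnth x (Ordinal n0) : R|).
    by apply: le_trans (ler_norm _); have /andP[] := Lx (Ordinal n0).
  rewrite -sqrtr_sqr ler_sqrt ?dotvv_ge0// /dotv (bigD1 (Ordinal n0))//= -expr2.
  by rewrite lerDl sumr_ge0// => j _; rewrite -expr2 sqr_ge0.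
have b0 : 0 <= 3 * n%:R * L by rewrite !mulr_ge0// ltW.
rewrite -(ger0_norm b0) -sqrtr_sqr ler_sqrt ?sqr_ge0//.
apply: (@le_trans _ _ (\sum_(i < n) (3 * L) ^+ 2)).
  apply: ler_sum => i _; rewrite -expr2 ler_sqr ?nnegrE ?mulr_ge0 ?(ltW L0)//.
    by have /andP[] := Lx i.
  by have /andP[/(le_trans (ltW L0))] := Lx i.
rewrite sumr_const card_ord -[leLHS]mulr_natl.
rewrite (_ : 3 * n%:R * L = n%:R * (3 * L)); last by ring.
by rewrite [leRHS]exprMn ler_wpM2r ?sqr_ge0// expr2 ler_peMl.
Qed.

Lemma dotv_box (L : R) (x y : vec) : 0 < L ->
  (forall i, 2 * L <= (tnth x i : R) <= 3 * L) ->
  (forall i, 0 <= (tnth y i : R) <= L) -> - (3 * n%:R * L ^+ 2) <= dotv x (oppv y) <= 0.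
Proof.
move=> L0 xL yL; rewrite /dotv; under eq_bigr do rewrite tnth_mktuple mulrN.
rewrite sumrN oppr_le0 lerN2; apply/andP; split.
  apply: (@le_trans _ _ (\sum_(i < n) 3 * L ^+ 2)).
    apply: ler_sum => i _; have /andP[x1 x2] := xL i; have /andP[y1 y2] := yL i.
    by rewrite expr2 mulrA; apply: ler_pM => //; apply: le_trans x1; rewrite mulr_ge0 ?ltW.
  by rewrite sumr_const card_ord -[leLHS]mulr_natl mulrCA mulrA.
apply: sumr_ge0 => i _; have /andP[x1 x2] := xL i; have /andP[y1 y2] := yL i.
by rewrite mulr_ge0//; apply: le_trans x1; rewrite mulr_ge0 ?ltW.
Qed.

(** [B * L ^+ 2] bounds the twist between the two test boxes, and [D] bounds the ratios of the two
    horizontal norms to L and of the last coordinate to L^2. *)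
Let B : R := 3 * n%:R * `|mu|.
Let D : R := 3 * n%:R + 2 * B + 3.

Definition kernel_const : R :=
  D `^ (- `|al - n%:R|) * D `^ (- `|al - n%:R|) * D `^ (- `|be - 1|) *
  (2 * D ^+ 2) `^ (- (`|al - n%:R * be| / n.+1%:R)).

Let B0 : 0 <= B.
Proof. by rewrite !mulr_ge0. Qed.

Let D1 : 1 <= D.
Proof. by have := ler0n R n; have := B0; rewrite /D; lra. Qed.

Lemma kernel_const_gt0 : 0 < kernel_const.
Proof.
have D0 : 0 < D by exact: lt_le_trans D1.
by rewrite /kernel_const !mulr_gt0 ?powR_gt0 ?mulr_gt0 ?exprn_gt0.
Qed.

(** In the group difference the horizontal norms are comparable to L and the last coordinate to L^2,
    within a factor [D]. Hence w and 1/w are at most D^2, and the powers of L collect to 2 (al - n)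
    + 2 (be - 1). *)
Lemma hkernel_box_ge (L : R) (x y : hpoint) : (0 < n)%N -> 0 < L ->
  hbox (2 * L) (3 * L) ((B + 2) * L ^+ 2) ((B + 3) * L ^+ 2) x ->
  hbox 0 L 0 (L ^+ 2) y ->
  kernel_const * L `^ (2 * (al + be) - (2 * n%:R + 2)) <=
  hkernel al be (hmul mu x (hinv y)).
Proof.
move: x y => [[u v] t] [[xi eta] tau] n0 L0 [[/= uL vL] /= tL] [[/= xiL etaL] /= tauL].
have nR : 1 <= n%:R :> R by rewrite ler1n.
have D0 : 0 < D by exact: lt_le_trans D1.
have {}uL i : 2 * L <= (tnth u i : R) <= 3 * L by have := uL i; rewrite /= in_itv.
have {}vL i : 2 * L <= (tnth v i : R) <= 3 * L by have := vL i; rewrite /= in_itv.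
have {}xiL i : 0 <= (tnth xi i : R) <= L by have := xiL i; rewrite /= in_itv.
have {}etaL i : 0 <= (tnth eta i : R) <= L by have := etaL i; rewrite /= in_itv.
move: tL tauL; rewrite !in_itv/= => /andP[t1 t2] /andP[tau1 tau2].
rewrite /hkernel.
set a := enorm _; set b := enorm _; set c := `|_|.
have aL : L <= a <= 3 * n%:R * L.
  apply: enorm_box => // i; rewrite !tnth_mktuple.
  by have := uL i; have := xiL i; lra.
have bL : L <= b <= 3 * n%:R * L.
  apply: enorm_box => // i; rewrite !tnth_mktuple.
  by have := vL i; have := etaL i; lra.
(* [t] is at least (B + 2) L^2, so removing [tau] and the twist, at most L^2 and B L^2, still leaves
   L^2. *)
have cL : L ^+ 2 <= c <= (2 * B + 3) * L ^+ 2.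
  have d1 := dotv_box L0 uL etaL; have d2 := dotv_box L0 vL xiL.
  (* Both dot products lie in the same interval of length 3 n L^2, which therefore bounds their
     difference. *)
  have : `|mu * (dotv u (oppv eta) - dotv v (oppv xi))| <= B * L ^+ 2.
    rewrite normrM (_ : B * _ = `|mu| * (3 * n%:R * L ^+ 2)); last by rewrite /B; ring.
    rewrite ler_wpM2l// ler_norml.
    by apply/andP; split; lra.
  rewrite ler_norml /c => /andP[m1 m2]; rewrite ger0_norm; first by apply/andP; split; lra.
  by have := sqr_ge0 L; lra.
have {}aL : L <= a <= D * L.
  case/andP: aL => -> /le_trans ->//; rewrite ler_wpM2r ?(ltW L0)// /D.
  by have := B0; lra.
have {}bL : L <= b <= D * L.
  case/andP: bL => -> /le_trans ->//; rewrite ler_wpM2r ?(ltW L0)// /D.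
  by have := B0; lra.
have L20 : 0 < L ^+ 2 by rewrite exprn_gt0.
have {}cL : L ^+ 2 <= c <= D * L ^+ 2.
  case/andP: cL => -> /le_trans ->//; rewrite ler_wpM2r ?(ltW L20)// /D.
  by have := B0; lra.
have a0 : 0 < a by case/andP: aL => /(lt_le_trans L0).
have b0 : 0 < b by case/andP: bL => /(lt_le_trans L0).
have c0 : 0 < c by case/andP: cL => /(lt_le_trans L20).
rewrite !gt_eqF//=.
have -> : L `^ (2 * (al + be) - (2 * n%:R + 2)) =
    L `^ (al - n%:R) * L `^ (al - n%:R) * (L ^+ 2) `^ (be - 1).
  rewrite -powR_mulrn ?(ltW L0)// -powRrM -!powRD ?(gt_eqF L0) ?implybT//.
  by congr (_ `^ _); ring.
set g := `|al - _ * be| / _.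
have g0 : 0 <= g by rewrite divr_ge0.
have gE : (2 * D ^+ 2) `^ (- g) <= (a * b / c + c / (a * b)) `^ (- g).
  rewrite !powRN lef_pV2 ?posrE ?powR_gt0 ?addr_gt0 ?divr_gt0 ?mulr_gt0 ?exprn_gt0//.
  rewrite ge0_ler_powR ?nnegrE ?addr_ge0 ?divr_ge0 ?mulr_ge0 ?exprn_ge0
    ?(ltW a0) ?(ltW b0) ?(ltW c0) ?(ltW D0)//.
  have [/andP[a1 a2] [/andP[b1 b2] /andP[c1 c2]]] := (aL, (bL, cL)).
  rewrite (_ : 2 * D ^+ 2 = D ^+ 2 + D ^+ 2); last by ring.
  apply: lerD.
    rewrite ler_pdivrMr//; apply: (@le_trans _ _ ((D * L) * (D * L))).
      by apply: ler_pM => //; exact: ltW.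
    rewrite (_ : _ * _ = D ^+ 2 * L ^+ 2); last by ring.
    by rewrite ler_wpM2l// exprn_ge0// ltW.
  rewrite ler_pdivrMr ?mulr_gt0//; apply: (le_trans c2); rewrite expr2 -mulrA.
  rewrite ler_wpM2l ?(ltW D0)//; apply: (@le_trans _ _ (1 * L ^+ 2)); first by rewrite mul1r.
  by rewrite ler_pM ?exprn_ge0 ?(ltW L0)// expr2 ler_pM ?(ltW L0).
have hA := powR_scale_ge (al - n%:R) L0 D1 aL.
have hB := powR_scale_ge (al - n%:R) L0 D1 bL.
have hC := powR_scale_ge (be - 1) L20 D1 cL.
apply: (@le_trans _ _ ((D `^ (- `|al - n%:R|) * L `^ (al - n%:R)) *
  (D `^ (- `|al - n%:R|) * L `^ (al - n%:R)) *
  (D `^ (- `|be - 1|) * (L ^+ 2) `^ (be - 1)) * (2 * D ^+ 2) `^ (- g))).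
  by rewrite /kernel_const -/g le_eqVlt; apply/predU1P; left; ring.
have Q0 (x y z w : R) : 0 <= x `^ y * z `^ w by rewrite mulr_ge0 ?powR_ge0.
rewrite (ler_pM _ (powR_ge0 _ _) _ gE) ?(mulr_ge0 (mulr_ge0 _ _) _) ?Q0//.
rewrite (ler_pM (mulr_ge0 (Q0 _ _ _ _) (Q0 _ _ _ _)) (Q0 _ _ _ _) _ hC)//.
exact: (ler_pM (Q0 _ _ _ _) (Q0 _ _ _ _) hA hB).
Qed.

Lemma hbox_Lfun (p l h l' h' : R) : 1 < p -> l <= h -> l' <= h' ->
  (\1_(hbox l h l' h') : hpoint -> R) \in Lfun hleb p%:E /\
  'N[hleb]_p%:E[EFin \o (\1_(hbox l h l' h') : hpoint -> R)]%E =
    (((h - l) ^+ (2 * n) * (h' - l')) `^ p^-1)%:E.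
Proof.
move=> p1 lh lh'; have p0 : 0 < p by exact: lt_trans p1.
have NE : 'N[hleb]_p%:E[EFin \o (\1_(hbox l h l' h') : hpoint -> R)]%E =
    (((h - l) ^+ (2 * n) * (h' - l')) `^ p^-1)%:E.
  rewrite unlock -poweR_EFin; congr (_ `^ _)%E.
  rewrite -hlebesgue_hbox// -[X in hleb X]setIT -integral_indic//; last first.
    exact: measurable_hbox.
  apply: eq_integral => x _; rewrite /= indicE.
  by case: (_ \in _); rewrite /= ?normr1 ?powR1// normr0 powR0// gt_eqF.
split => //; apply/andP; split; rewrite inE.
  by apply: measurable_indic; exact: measurable_hbox.
by rewrite /= /finite_norm NE ltry.
Qed.

(** Both test boxes have volume L^(2n + 2), and the image of the first indicator is at least kc
    L^(2(al + be)) on the second box. Comparing norms bounds kc L^eps by [C] for small and large L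
    alike, which forces eps = 0. *)
Theorem hfracint_bounded_exponents (p q C : R) : (0 < n)%N -> 1 < p -> 0 < q ->
  0 < C -> hfracint_bounded n mu al be p q C ->
  (al + be) / n.+1%:R = 1 / p - 1 / q.
Proof.
move=> n0 p1 q0 C0 H; have p0 : 0 < p by exact: lt_trans p1.
move: kernel_const kernel_const_gt0 hkernel_box_ge => kc k0 kbox.
pose eps := 2 * (al + be) + (2 * n%:R + 2) * (q^-1 - p^-1).
have key (L : R) : 0 < L -> kc * L `^ eps <= C.
  move=> L0; have L20 : 0 < L ^+ 2 by rewrite exprn_gt0.
  pose G := L `^ (2 * n%:R + 2).
  have GE : L ^+ (2 * n) * L ^+ 2 = G.
    by rewrite /G -!powR_mulrn ?(ltW L0)// -powRD ?(gt_eqF L0) ?implybT// natrM.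
  pose A := hbox 0 L 0 (L ^+ 2).
  pose E := hbox (2 * L) (3 * L) ((B + 2) * L ^+ 2) ((B + 3) * L ^+ 2).
  have [fL fN] := hbox_Lfun p1 (ltW L0) (ltW L20).
  have mA : measurable A := measurable_hbox _ _ _ _.
  have mE : measurable E := measurable_hbox _ _ _ _.
  have [_] := H _ fL; rewrite fN !subr0 GE.
  (* This is the lower bound of the kernel times the volume of [A], which cancels the term -(2n + 2)
     in the exponent. *)
  pose c := kc * L `^ (2 * (al + be)).
  have c0 : 0 < c by rewrite mulr_gt0// powR_gt0.
  have muA : hleb A = G%:E by rewrite hlebesgue_hbox ?(ltW L0) ?(ltW L20)// !subr0 GE.
  have muE : hleb E = G%:E.
    rewrite hlebesgue_hbox.
    - by rewrite -GE; congr ((_ ^+ _ * _)%:E); ring.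
    - by lra.
    - by rewrite ler_wpM2r ?(ltW L20)//; lra.
  have If x : E x -> (c%:E <= `|hfracint mu al be (\1_A) x|)%E.
    move=> Ex; rewrite gee0_abs; last first.
      by apply: integral_ge0 => y _; rewrite lee_fin mulr_ge0 ?hkernel_ge0.
    pose k := kc * L `^ (2 * (al + be) - (2 * n%:R + 2)).
    have kE : (c%:E = \int[hleb]_y (k%:E * (\1_A y)%:E))%E.
      rewrite ge0_integralZl//.
      - rewrite integral_indic// setIT; transitivity (k%:E * G%:E)%E.
          rewrite -EFinM /c /k /G -mulrA -powRD ?(gt_eqF L0) ?implybT//.
          by rewrite subrK.
        by congr (_ * _)%E.
      - by apply/measurable_EFinP; exact: measurable_indic.
      - by rewrite lee_fin mulr_ge0 ?powR_ge0// ltW.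
    rewrite kE; apply: ge0_le_integralT => y.
      by rewrite mule_ge0// lee_fin// mulr_ge0 ?powR_ge0// ltW.
    rewrite /hintegrand -EFinM lee_fin indicE.
    case: (boolP (y \in A)) => [/set_mem yA|_]; last by rewrite mulr0 mul0r.
    by rewrite mulr1 mul1r; exact: (kbox L).
  have : ((c * G `^ q^-1)%:E <= 'N[hleb]_q%:E[hfracint mu al be (\1_A)])%E.
    have -> : (c * G `^ q^-1)%:E = ((c `^ q * G)%:E `^ q^-1)%E.
      rewrite poweR_EFin powRM ?powR_ge0// -powRrM mulfV ?gt_eqF// powRr1//.
      exact: ltW.
    rewrite unlock; apply: gt0_ler_poweR; rewrite ?invr_ge0 ?(ltW q0)// ?in_itv/= ?leey ?andbT.
    - by rewrite lee_fin mulr_ge0 ?powR_ge0.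
    - by apply: integral_ge0 => x _; exact: poweR_ge0.
    have -> : ((c `^ q * G)%:E = \int[hleb]_x ((c `^ q)%:E * (\1_E x)%:E))%E.
      rewrite ge0_integralZl//.
      - rewrite integral_indic// setIT EFinM.
        by congr (_ * _)%E.
      - by apply/measurable_EFinP; exact: measurable_indic.
      - by rewrite lee_fin powR_ge0.
    apply: ge0_le_integralT => x; first by rewrite mule_ge0// lee_fin// powR_ge0.
    rewrite indicE; case: (boolP (x \in E)) => [/set_mem xE|_].
      rewrite mule1 -poweR_EFin; apply: gt0_ler_poweR;
        rewrite ?(ltW q0) ?in_itv/= ?leey ?andbT ?abse_ge0//.
        by rewrite lee_fin ltW.
      exact: If.
    by rewrite mule0 poweR_ge0.
  move=> /le_trans /[apply]; rewrite -EFinM lee_fin => Hle.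
  have G0 : 0 < G `^ p^-1 by rewrite !powR_gt0.
  rewrite -(ler_pM2r G0); apply: le_trans Hle.
  rewrite /c /G -!powRrM -!mulrA -!powRD ?(gt_eqF L0) ?implybT//.
  rewrite ler_wpM2l ?(ltW k0)// le_eqVlt; apply/predU1P; left; congr (_ `^ _).
  by rewrite /eps; ring.
have eps0 : eps = 0.
  apply/eqP/negPn/negP => eN.
  (* For L = (C / kc + 1)^(1/eps) the quantity kc L^eps equals C + kc, which exceeds [C]. *)
  have y0 : 0 < C / kc + 1 by rewrite addr_gt0 ?divr_gt0.
  have := key _ (powR_gt0 eps^-1 y0).
  rewrite -powRrM mulVf// powRr1 ?(ltW y0)// mulrDr mulr1 mulrCA mulfV ?gt_eqF// mulr1.
  by rewrite leNgt ltrDl k0.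
have nN : n.+1%:R != 0 :> R by rewrite pnatr_eq0.
rewrite !div1r; apply: (mulIf nN); rewrite divfK//.
by move: eps0; rewrite /eps -natr1; lra.
Qed.

End Necessity.

(* The second conjunct says that the constant depends only on p and q (n and mu
   being fixed): it can be chosen uniformly in alpha and beta. *)
Theorem mainTheorem2 (R : realType) (n : nat) (hn : (1 <= n)%N) (mu p q : R)
    (hp : 1 < p) (hpq : p < q) :
  (forall alpha beta : R,
    (exists C : R, 0 < C /\ hfracint_bounded n mu alpha beta p q C) <->
    (alpha + beta) / n.+1%:R = 1 / p - 1 / q) /\
  (exists C : R, 0 < C /\
    forall alpha beta : R,
      (alpha + beta) / n.+1%:R = 1 / p - 1 / q ->
      hfracint_bounded n mu alpha beta p q C).
Proof.
have q0 : 0 < q by apply: lt_trans hpq; exact: lt_trans hp.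
have [C [C0 HC]] : exists C : R, 0 < C /\ forall alpha beta : R,
    (alpha + beta) / n.+1%:R = 1 / p - 1 / q ->
    hfracint_bounded n mu alpha beta p q C.
  exists (hfrac_const n (1 - q^-1) p^-1); split; last first.
    by move=> al be; exact: hfracint_bounded_suff.
  by have [s01 t01 st] := dual_exponents hp hpq; exact: hfrac_const_gt0.
split; last by exists C.
move=> al be; split => [[C' [C'0 H]]|/HC H]; last by exists C.
exact: (hfracint_bounded_exponents hn hp q0 C'0 H).
Qed.
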